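(* Let $H$ be a graph with $e_H\ge 1$ edges. Then the online Ramsey number satisfies $$\tilde r(H,k)=\Omega\bigl(k\cdot (k/\log k)^{m_2(H)}\bigr)\quad\text{as } k\to\infty,$$ where the implicit constant may depend on $H$.
   Context: For a graph $F$ write $v_F:=|V(F)|$ and $e_F:=|E(F)|$. For a graph $H$ define $$m_2(H):=\max_{F\subseteq H}\Bigl(\mathbf 1_{\{v_F\ge 3\}}\tfrac{e_F-1}{v_F-2}+\mathbf 1_{\{F=K_2\}}\tfrac12\Bigr),$$ where the maximum is over all subgraphs $F$ of $H$. (For $v_F\le 2$ the first term is interpreted as $0$.) $K_k$ denotes the clique on $k$ vertices. Online Ramsey game: this is a game between two players, Builder and Painter, starting with an infinite set $V=\{1,2,\dots\}$ of isolated vertices. In each turn, Builder places an edge between two non-adjacent vertices from $V$, and Painter immediately colors it either red or blue. The online Ramsey number $\tilde r(H,k)$ is the smallest number of turns $N$ that Builder needs to guarantee the existence of either a red copy of $H$ or a blue copy of $K_k$ (regardless of Painter's strategy). *)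

(* Defs.v *)
From HB Require Import structures.
From mathcomp Require Import all_boot all_order all_algebra.
From mathcomp Require Import boolp reals.

Set Implicit Arguments.
Unset Strict Implicit.
Unset Printing Implicit Defensive.

Record sgraph := SGraph {
  vertex :> finType;
  adj : rel vertex;
  adj_sym : symmetric adj;
  adj_irr : irreflexive adj }.

Definition edges (H : sgraph) : {set {set H}} :=
  [set [set p.1; p.2] | p in [pred p : H * H | adj p.1 p.2]].

Lemma neq_sym (T : eqType) : symmetric (fun x y : T => x != y).
Proof. by move=> x y; rewrite eq_sym. Qed.

Lemma neq_irr (T : eqType) : irreflexive (fun x y : T => x != y).
Proof. by move=> x; rewrite eqxx. Qed.

Definition complete (k : nat) : sgraph :=
  SGraph (@neq_sym 'I_k) (@neq_irr 'I_k).

Section M2.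
Import GRing.Theory Num.Theory.
Local Open Scope ring_scope.

(* A subgraph is a pair (vertex set, edge set), not necessarily induced or
   spanning. *)
Definition is_subgraph (H : sgraph) (F : {set H} * {set {set H}}) : bool :=
  (F.2 \subset edges H) && [forall e in F.2, e \subset F.1].

(* The numerator is a subtraction in R: it is -1 for an edgeless F. *)
Definition m2_term (R : realFieldType) (H : sgraph)
    (F : {set H} * {set {set H}}) : R :=
  (if (3 <= #|F.1|)%N then (#|F.2|%:R - 1) / (#|F.1|%:R - 2) else 0) +
  (if (#|F.1| == 2)%N && (#|F.2| == 1)%N then 1 / 2 else 0).

(* The default value 0 is harmless: it is the term of the empty subgraph. *)
Definition m2 (R : realFieldType) (H : sgraph) : R :=
  \big[Num.max/0]_(F : {set H} * {set {set H}} | is_subgraph F) m2_term R F.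

End M2.

(* The board is the vertex set nat.  A history lists the edges placed so far,
   most recent first, with the color given by Painter. *)
Definition color := bool.
Definition red : color := true.
Definition blue : color := false.
Definition history := seq ((nat * nat) * color).

Definition colored (h : history) (c : color) : rel nat :=
  fun u v => (((u, v), c) \in h) || (((v, u), c) \in h).

Definition placed (h : history) : rel nat :=
  fun u v => colored h red u v || colored h blue u v.

Definition legal_move (h : history) (e : nat * nat) : bool :=
  (e.1 != e.2) && ~~ placed h e.1 e.2.

Definition builder_strategy := history -> nat * nat.
Definition painter_strategy := history -> nat * nat -> color.

Definition legal (b : builder_strategy) : Prop := forall h, legal_move h (b h).

Fixpoint play (b : builder_strategy) (p : painter_strategy) (n : nat) :
    history :=
  if n is n'.+1 then
    let h := play b p n' in let e := b h in (e, p h e) :: h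
  else [::].

Definition has_copy (H : sgraph) (E : rel nat) : Prop :=
  exists f : H -> nat, injective f /\ forall x y, adj x y -> E (f x) (f y).

(* Copies persist and Builder can always move, so "within N turns" and
   "after exactly N turns" agree. *)
Definition builder_forces (H : sgraph) (k N : nat) : Prop :=
  exists b, legal b /\ forall p,
    has_copy H (colored (play b p N) red) \/
    has_copy (complete k) (colored (play b p N) blue).

Lemma coloredC h c : symmetric (colored h c).
Proof. by move=> u v; rewrite /colored orbC. Qed.

Lemma ramsey_pairwise (a b : nat) : exists M, forall (c : rel nat) (s : seq nat),
  M <= size s ->
  (exists t, [/\ subseq t s, size t = a & pairwise c t]) \/
  (exists t, [/\ subseq t s, size t = b & pairwise (fun x y => ~~ c x y) t]).
Proof.
have [n] := ubnP (a + b); elim: n a b => // n IHn [|a] [|b] ltn.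
- by exists 0 => c s _; left; exists [::]; rewrite sub0seq.
- by exists 0 => c s _; left; exists [::]; rewrite sub0seq.
- by exists 0 => c s _; right; exists [::]; rewrite sub0seq.
have [|M1 h1] := IHn a b.+1; first by rewrite -ltnS.
have [|M2 h2] := IHn a.+1 b; first by rewrite addSnnS -ltnS.
exists (M1 + M2).+1 => c [|x s] //=; rewrite ltnS => lesz.
pose s1 := filter (c x) s; pose s2 := filter (predC (c x)) s.
have sz : size s1 + size s2 = size s by rewrite !size_filter count_predC.
have cons_ok (q : pred nat) t : subseq t (filter q s) ->
    subseq (x :: t) (x :: s) && all q t.
  move=> st; rewrite /= eqxx (subseq_trans st (filter_subseq _ _)) /=.
  by apply/allP => y /(mem_subseq st); rewrite mem_filter => /andP[].
have weak (q : pred nat) t : subseq t (filter q s) -> subseq t (x :: s).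
  move=> st; apply: (subseq_trans st).
  exact: subseq_trans (filter_subseq _ _) (subseq_cons _ _).
have [le1|lt1] := leqP M1 (size s1).
  have [[t [st sz_t pt]]|[t [st sz_t pt]]] := h1 c s1 le1.
    left; exists (x :: t); have /andP[sub qt] := cons_ok _ _ st.
    by split; rewrite //= ?sz_t // qt.
  by right; exists t; split=> //; exact: weak st.
have le2 : M2 <= size s2.
  by rewrite -(leq_add2l (size s1)) sz (leq_trans _ lesz) // leq_add2r ltnW.
have [[t [st sz_t pt]]|[t [st sz_t pt]]] := h2 c s2 le2.
  by left; exists t; split=> //; exact: weak st.
right; exists (x :: t); have /andP[sub qt] := cons_ok _ _ st.
by split; rewrite //= ?sz_t // pt andbT.
Qed.

Lemma has_copy_pairwise (H : sgraph) (E : rel nat) (t : seq nat) :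
  symmetric E -> uniq t -> size t = #|H| -> pairwise E t -> has_copy H E.
Proof.
move=> symE uniq_t sz_t /(pairwiseP 0) pt.
have lt_t (x : H) : enum_rank x < size t by rewrite sz_t ltn_ord.
exists (fun x => nth 0 t (enum_rank x)); split=> [x y /eqP|x y xy].
  by rewrite nth_uniq // => /eqP/val_inj/enum_rank_inj.
case: (ltngtP (enum_rank x) (enum_rank y)) => [lt_xy|lt_yx|].
- by apply: pt; rewrite ?inE.
- by rewrite symE; apply: pt; rewrite ?inE.
- by move=> /val_inj/enum_rank_inj eq_xy; rewrite eq_xy adj_irr in xy.
Qed.

Lemma fresh_move (h : history) : exists e, legal_move h e.
Proof.
suff [m mP] : exists m, forall x, x \in h -> x.1.1 + x.1.2 < m.
  exists (m, m.+1); rewrite /legal_move /= neq_ltn ltnSn /= /placed /colored.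
  by apply/negP => /orP[] /orP[] /mP /=; rewrite ltnNge ?leq_addr ?leq_addl.
elim: h => [|y h [m mP]]; first by exists 0.
exists (m + (y.1.1 + y.1.2).+1) => x; rewrite inE => /predU1P[->|/mP lt_x].
  by rewrite leq_addl.
by rewrite ltn_addr.
Qed.

(* Finiteness, by Ramsey's theorem: Builder fills in a large clique. *)
Lemma builder_forces_some (H : sgraph) (k : nat) :
  exists N, `[< builder_forces H k N >].
Proof.
have [M ramM] := ramsey_pairwise #|H| k.
pose L := [seq (u, v) | u <- iota 0 M, v <- iota 0 M].
pose b : builder_strategy := fun h =>
  nth (xchoose (fresh_move h)) L (find (legal_move h) L).
have legal_b : legal b.
  move=> h; rewrite /b; have [hasL|hasNL] := boolP (has (legal_move h) L).
    exact: nth_find.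
  by rewrite hasNfind // nth_default //; exact: xchooseP.
have count_play p n : count (legal_move (play b p n)) L <= size L - n.
  elim: n => [|n]; first by rewrite subn0 count_size.
  set h := play b p n => IHn; rewrite [play _ _ _]/= -/h.
  set h' := _ :: h.
  have sub : subpred (legal_move h') (legal_move h).
    move=> e /andP[ne pl]; rewrite /legal_move ne /=; apply: contra pl.
    by rewrite /placed /colored !inE => /orP[] /orP[] ->; rewrite ?orbT.
  have [hasL|] := boolP (has (legal_move h) L); last first.
    rewrite has_count -leqNgt leqn0 => /eqP c0.
    by rewrite (leq_trans (sub_count sub _)) // c0.
  have bL : b h \in L by rewrite /b mem_nth // -has_find.
  have nb : ~~ legal_move h' (b h).
    rewrite /legal_move /placed /colored !inE -surjective_pairing.
    by case: (p h (b h)); rewrite eqxx ?orbT andbF.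
  suff lt : count (legal_move h') L < count (legal_move h) L.
    by rewrite subnS -ltnS; case: (size L - n) IHn (leq_trans lt IHn).
  have := count_predUI (legal_move h') (pred1 (b h)) L.
  rewrite (@eq_count _ (predI _ _) pred0) ?count_pred0 => [|e /=]; last first.
    by have [->|_] := eqVneq e (b h); [rewrite (negbTE nb)|rewrite andbF].
  rewrite addn0 => eqc.
  apply: (@leq_trans (count (predU (legal_move h') (pred1 (b h))) L)).
    by rewrite eqc -addn1 leq_add2l -has_count has_pred1.
  by apply: sub_count => e /= /orP[/sub//|/eqP->]; exact: legal_b.
exists (size L); apply/asboolP; exists b; split=> // p.
set h := play _ _ _.
have full u v : u < M -> v < M -> u != v -> placed h u v.
  move=> uM vM uv; have := count_play p (size L).
  rewrite subnn leqn0 -/h => /eqP c0; apply/negPn/negP => npl.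
  suff : has (legal_move h) L by rewrite has_count c0.
  apply/hasP; exists (u, v); last by rewrite /legal_move uv.
  by apply/allpairsP; exists (u, v); rewrite !mem_iota !add0n.
have [|[t [st sz pt]]|[t [st sz pt]]] := ramM (colored h red) (iota 0 M).
- by rewrite size_iota.
- by left; apply: has_copy_pairwise pt; rewrite ?(subseq_uniq st) ?iota_uniq //;
    exact: coloredC.
- have ut : uniq t by rewrite (subseq_uniq st) ?iota_uniq.
  right; apply: (@has_copy_pairwise _ _ t) => //.
  + exact: coloredC.
  + by rewrite sz card_ord.
  apply/(pairwiseP 0) => i j it jt ij.
  have ltM l : l < size t -> nth 0 t l < M.
    by move=> /(mem_nth 0)/(mem_subseq st); rewrite mem_iota add0n.
  have /orP[|//] : placed h (nth 0 t i) (nth 0 t j).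
    by apply: full; rewrite ?ltM // nth_uniq // ltn_eqF.
  by move/(pairwiseP 0): pt => /(_ i j it jt ij) /negbTE->.
Qed.

Definition online_ramsey (H : sgraph) (k : nat) : nat :=
  ex_minn (builder_forces_some H k).

(* Main.v *)
Require Import Defs.
From mathcomp Require Import all_boot all_order all_algebra.
From mathcomp Require Import boolp reals sequences exp.
From mathcomp Require Import lra ring zify.
Set Implicit Arguments.
Unset Strict Implicit.
Unset Printing Implicit Defensive.
Import Order.TTheory GRing.Theory Num.Theory.
Local Open Scope ring_scope.

(** If m_2 <= 1, always answering blue is enough, as K_k has k(k-1)/2 edges.
    Otherwise some subgraph F of H with v vertices and e edges attains
    m_2 = (e-1)/(v-2); taken with fewest edges it is strictly balanced.  The
    painter plays with a random set G of pairs of labels from 'I_n, each pair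
    taken with probability q = C log k / k, where n is c (k / log k)^m_2.  A
    vertex gets the next free label when its degree reaches k/8, so about n k
    turns use at most n labels.  An edge is painted red iff both its ends are
    labelled, their pair of labels is in G, and no red F arises.

    Let W be the label set of a blue K_k.  At most k^2/8 of its edges were
    placed while one end had no label.  The painter always answered blue inside
    W, so the play is the one that arises from G minus the pairs inside W: the
    set Q of pairs inside W that were asked while labelled and not closing a red
    F is independent of G inside W, and it must avoid G.  If |Q| >= k^2/32 this
    has probability at most (1-q)^|Q|, which beats the number of sets W.
    Otherwise a constant proportion of the pairs inside W are closed by copies
    in G of F minus an edge.  This is excluded by a moment of order about
    k log k of the number of such copies, computed on the event that no pair has
    many more extensions to a proper subgraph of F than expected; that event is
    itself controlled by a moment of order about log k. *)

(** * Random subsets of a finite type *)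

Section RandomSet.
Variables (R : realFieldType) (T : finType) (q : R).
Hypotheses (q0 : 0 <= q) (q1 : q <= 1).
Implicit Types (A B G U : {set T}).

Definition weight G : R := \prod_(t : T) (if t \in G then q else 1 - q).

Definition Pr (P : {set T} -> bool) : R := \sum_(G | P G) weight G.

Let onem_q : 0 <= 1 - q. Proof. by rewrite subr_ge0. Qed.

Lemma weight_ge0 G : 0 <= weight G.
Proof. by apply: prodr_ge0 => t _; case: ifP. Qed.

Lemma Pr_box A B : [disjoint A & B] ->
  Pr (fun G => (A \subset G) && [disjoint G & B]) = q ^+ #|A| * (1 - q) ^+ #|B|.
Proof.
move=> dAB; rewrite /Pr.
(* [F] and [F'] weigh the choices of putting [t] in [G] or not, with 0 for a forbidden choice;
   expanding the product of their sums runs over all [G]. *)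
pose F t : R := if t \in B then 0 else q.
pose F' t : R := if t \in A then 0 else 1 - q.
transitivity (\prod_(t : T) (F t + F' t)).
  rewrite bigA_distr big_mkcond /=; apply: eq_bigr => G _.
  case: ifPn => [/andP[/subsetP AG /pred0P GB]|].
    apply: eq_bigr => t _; rewrite /F /F'; case: ifPn => tG.
      by have := GB t; rewrite /= tG /= => ->.
    by case: ifPn => // /AG; rewrite (negbTE tG).
  rewrite negb_and => /orP[/subsetPn[t tA tG]|/pred0Pn[t /andP[/= tG tB]]].
    by rewrite (bigD1 t) //= (negbTE tG) /F' tA mul0r.
  by rewrite (bigD1 t) //= tG /F tB mul0r.
rewrite (bigID (fun t => t \in A)) /= (eq_bigr (fun=> q)) ?prodr_const => [|t tA]; last first.
  by rewrite /F /F' tA (disjointFr dAB tA) addr0.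
congr (_ * _); rewrite (bigID (fun t => t \in B)) /= (eq_bigl (fun t => t \in B)); last first.
  move=> t /=; case tB: (t \in B); rewrite ?andbF // andbT.
  by rewrite (disjointFl dAB tB).
rewrite (eq_bigr (fun=> 1 - q)) ?prodr_const => [|t tB]; last first.
  by rewrite /F /F' tB (disjointFl dAB tB) add0r.
rewrite big1 ?mulr1 // => t /andP[/negbTE tA /negbTE tB].
by rewrite /F /F' tA tB addrC subrK.
Qed.

Lemma Pr_sub A : Pr (fun G => A \subset G) = q ^+ #|A|.
Proof.
have d0 G : [disjoint G & set0] by rewrite disjoint_sym disjoints_subset sub0set.
rewrite -[RHS]mulr1 -(expr0 (1 - q)) -(cards0 T) -Pr_box //.
by apply: eq_bigl => G; rewrite d0 andbT.
Qed.

Lemma Pr_predT : Pr (fun=> true) = 1.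
Proof.
rewrite -(expr0 q) -(cards0 T) -Pr_sub.
by apply: eq_bigl => G; rewrite /= sub0set.
Qed.

Lemma Pr_le (P P' : {set T} -> bool) : (forall G, P G -> P' G) -> Pr P <= Pr P'.
Proof.
move=> PP'; rewrite /Pr big_mkcond [leRHS]big_mkcond /=.
apply: ler_sum => G _; case: ifPn => [/PP'|_]; first by move=> ->.
by case: ifP; rewrite ?weight_ge0.
Qed.

(** The union bound. *)
Lemma Pr_exists (I : finType) (D : pred I) (P : I -> {set T} -> bool) (x : R) :
  (forall i, D i -> Pr (P i) <= x) ->
  Pr (fun G => [exists (i | D i), P i G]) <= #|D|%:R * x.
Proof.
move=> Px; apply: (@le_trans _ _ (\sum_(i | D i) Pr (P i))); last first.
  by rewrite mulr_natl -sumr_const; apply: ler_sum.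
rewrite /Pr (exchange_big_dep predT) //= big_mkcond /=.
apply: ler_sum => G _; case: ifPn => [/existsP[i /andP[Di PiG]]|_].
  rewrite (bigD1 i) ?Di //= lerDl; apply: sumr_ge0 => *; exact: weight_ge0.
by apply: sumr_ge0 => *; exact: weight_ge0.
Qed.

(* The set [Q (G :\: P)] of forbidden elements depends on [G] only outside [P],
   so it is independent of [G :&: P]. *)
Lemma Pr_avoid (P : {set T}) (Q : {set T} -> {set T}) (l : nat) :
  (forall A, Q A \subset P) ->
  Pr (fun G => [disjoint G & Q (G :\: P)] && (l <= #|Q (G :\: P)|)%N)
    <= (1 - q) ^+ l.
Proof.
move=> QP.
have part A : A \subset ~: P ->
  Pr (fun G : {set T} => G :\: P == A) = q ^+ #|A| * (1 - q) ^+ #|~: (A :|: P)|.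
  move=> AP; rewrite -Pr_box; last first.
    by rewrite disjoints_subset setCK subsetUl.
  apply: eq_bigl => G; apply/eqP/andP => [<-|[AG]].
    by rewrite subsetDl disjoints_subset setCK; split=> //; apply/subsetP => t;
      rewrite !inE => ->; case: (t \in P).
  rewrite disjoints_subset setCK => /subsetP GAP; apply/setP => t; rewrite !inE.
  case tA: (t \in A).
    by have := subsetP AP _ tA; rewrite inE (subsetP AG _ tA) => ->.
  case tP: (t \in P) => //=; case tG: (t \in G) => //.
  by have := GAP _ tG; rewrite !inE tA tP.
have -> : (1 - q) ^+ l = (1 - q) ^+ l * Pr (fun=> true) by rewrite Pr_predT mulr1.
rewrite /Pr.
(* Condition on [A = G :\: P]; there [Q (G :\: P)] is the fixed set [Q A]. *)
rewrite (partition_big (fun G => G :\: P) (fun A => A \subset ~: P)) /=; last first.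
  by move=> G _; rewrite setDE subsetIr.
rewrite [X in _ * X](partition_big (fun G => G :\: P) (fun A => A \subset ~: P)) /=; last first.
  by move=> G _; rewrite setDE subsetIr.
rewrite mulr_sumr; apply: ler_sum => A AP.
rewrite -[X in _ <= _ * X]/(Pr (fun G : {set T} => G :\: P == A)) part //.
have [lQ|lQ] := leqP l #|Q A|; last first.
  rewrite big1 ?mulr_ge0 ?exprn_ge0 // => G /andP[/andP[_ lG] /eqP GA].
  by move: lG; rewrite GA leqNgt lQ.
have dQ : [disjoint ~: (A :|: P) & Q A].
  rewrite disjoints_subset setCS; apply: subset_trans (QP A) _.
  by rewrite subsetUr.
(* Inside [P], the set [G] has to avoid [Q A]; these avoided elements give the extra power of
   [1 - q]. *)
apply: (@le_trans _ _ (q ^+ #|A| * (1 - q) ^+ #|~: (A :|: P) :|: Q A|)).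
  rewrite -Pr_box; last first.
    rewrite disjoints_subset setCU setCK; apply/subsetP => t tA.
    rewrite !inE tA /=; apply/negP => /(subsetP (QP A)).
    by have := subsetP AP _ tA; rewrite inE => /negbTE->.
  apply: Pr_le => G /andP[/andP[dGQ _] /eqP GA].
  move: dGQ; rewrite GA => dGQ; apply/andP; split; first by rewrite -GA subsetDl.
  rewrite disjoints_subset setCU setCK subsetI; apply/andP; split.
    by rewrite -GA; apply/subsetP => t tG; rewrite !inE tG; case: (t \in P).
  by rewrite -disjoints_subset.
rewrite cardsU disjoint_setI0 // cards0 subn0 exprD mulrA [leRHS]mulrC.
rewrite ler_wpM2l ?mulr_ge0 ?exprn_ge0 //.
by rewrite ler_wiXn2l // gerBl.
Qed.

(** Expand the [r]-th power one factor at a time. If [U] is the union of the sets chosen so far,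
    asking for one more [S i] costs [q ^+ #|S i :\: U|], and these costs sum to at most [M]. The
    event [good] is kept throughout, so that the sum only has to be controlled for [U] inside a good
    set. *)
Lemma moment (I : finType) (D : pred I) (S : I -> {set T}) (good : {set T} -> bool)
    (s r : nat) (M : R) :
  0 <= M ->
  (forall i, D i -> #|S i| <= s)%N ->
  (forall U G, U \subset G -> good G -> (#|U| <= s * r)%N ->
     \sum_(i | D i) q ^+ #|S i :\: U| <= M) ->
  \sum_(G | good G) weight G * #|[set i | D i & S i \subset G]|%:R ^+ r <= M ^+ r.
Proof.
move=> M0 Ss SM; pose X G : R := #|[set i | D i & S i \subset G]|%:R.
(* [j] factors are still to be expanded; [U] stands for the union of the [r - j] sets already
   chosen. *)
have main j : (j <= r)%N -> forall U, (#|U| <= s * (r - j))%N ->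
    \sum_(G | good G && (U \subset G)) weight G * X G ^+ j <= q ^+ #|U| * M ^+ j.
  elim: j => [|j IHj] jr U Us.
    rewrite expr0 mulr1 -Pr_sub; under eq_bigr do rewrite expr0 mulr1.
    by apply: (@Pr_le (fun G => good G && (U \subset G))) => G;
      case/andP.
  (* If no good set contains [U] the sum is empty; otherwise [G0] makes the hypothesis [SM]
     applicable to [U]. *)
  have [/existsP[G0 /andP[gG0 UG0]]|] := boolP [exists G, good G && (U \subset G)];
    last first.
    rewrite negb_exists => /forallP noG; rewrite big1 ?mulr_ge0 ?exprn_ge0 //.
    by move=> G; rewrite (negbTE (noG G)).
  have sub G : X G = \sum_(i | D i) (S i \subset G)%:R.
    rewrite /X -sum1_card natr_sum [LHS]big_mkcond [RHS]big_mkcond /=.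
    by apply: eq_bigr => i _; rewrite inE; case: (D i) => //=; case: (_ \subset _).
  apply: (@le_trans _ _ (\sum_(i | D i) q ^+ #|U :|: S i| * M ^+ j)).
    under eq_bigr do rewrite exprSr mulrA [X in _ * X]sub mulr_sumr.
    rewrite exchange_big /=; apply: ler_sum => i Di.
    rewrite [leLHS](_ : _ = \sum_(G | good G && (U :|: S i \subset G)) weight G * X G ^+ j).
    2: { rewrite big_mkcond [RHS]big_mkcond; apply: eq_bigr => G _ /=.
      rewrite subUset andbA; case: (good G && _) => //=.
      by case: (_ \subset _); rewrite ?mulr1 ?mulr0. }
    apply: IHj; first exact: ltnW.
    rewrite (leq_trans (leq_card_setU _ _)) //.
    have -> : (r - j = (r - j.+1).+1)%N by rewrite subnSK.
    by rewrite mulnS addnC leq_add // Ss.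
  have -> : \sum_(i | D i) q ^+ #|U :|: S i| * M ^+ j
      = q ^+ #|U| * M ^+ j * \sum_(i | D i) q ^+ #|S i :\: U|.
    rewrite mulr_sumr; apply: eq_bigr => i _.
    rewrite mulrAC -exprD; congr (_ ^+ _ * _).
    rewrite -(cardsID U (U :|: S i)); congr (_ + _)%N; apply: eq_card => t;
      by rewrite !inE; case: (t \in U); rewrite ?andbF ?andbT ?orbT.
  rewrite exprSr mulrA ler_wpM2l ?mulr_ge0 ?exprn_ge0 //.
  by apply: (SM U G0) => //; apply: leq_trans Us _; rewrite leq_mul2l leq_subr orbT.
have := main r (leqnn _) set0; rewrite subnn muln0 cards0 expr0 mul1r => /(_ isT).
by under eq_bigl do rewrite sub0set andbT.
Qed.

(** Markov's inequality for the [r]-th power. *)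
Lemma Pr_moment (I : finType) (D : pred I) (S : I -> {set T}) (good : {set T} -> bool)
    (s r : nat) (lam M : R) :
  0 < lam -> 0 < M ->
  (forall i, D i -> #|S i| <= s)%N ->
  (forall U G, U \subset G -> good G -> (#|U| <= s * r)%N ->
     \sum_(i | D i) q ^+ #|S i :\: U| <= M) ->
  Pr (fun G => good G && (lam * M < #|[set i | D i & S i \subset G]|%:R))
    <= lam ^- r.
Proof.
move=> lam0 M0 Ss SM; have := moment (ltW M0) Ss SM.
move=> mom; rewrite -[leRHS]mul1r ler_pdivlMr ?exprn_gt0 //.
rewrite -(ler_pM2r (exprn_gt0 r M0)) mul1r -mulrA -exprMn.
apply: le_trans mom; rewrite /Pr mulr_suml /=.
rewrite big_mkcond [leRHS]big_mkcond; apply: ler_sum => G _ /=.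
case: (good G) => //=; case: ifPn => [lt|_]; last first.
  by rewrite mulr_ge0 ?weight_ge0 ?exprn_ge0.
rewrite ler_wpM2l ?weight_ge0 //; apply: lerXn2r; rewrite ?nnegrE ?ler0n //.
- by rewrite mulr_ge0 ?ltW.
- exact: ltW.
Qed.

End RandomSet.

(** * Copies of a strictly balanced graph in a random graph *)

Lemma leq_card_bigcup (I T : finType) (P : pred I) (F : I -> {set T}) :
  (#|\bigcup_(i | P i) F i| <= \sum_(i | P i) #|F i|)%N.
Proof.
elim/big_rec2: _ => [|i m A _ le]; first by rewrite cards0.
by rewrite (leq_trans (leq_card_setU _ _)) // leq_add2l.
Qed.

Lemma card_cover2 (T : finType) (U : {set {set T}}) :
  (forall x, x \in U -> #|x| = 2)%N -> (#|cover U| <= 2 * #|U|)%N.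
Proof.
move=> U2; apply: leq_trans (leq_card_cover U) _.
by rewrite (eq_bigr (fun=> 2)%N) ?sum_nat_const 1?mulnC.
Qed.

(** If the cover had at most two points, every pair of [J] would be equal to it. *)
Lemma cover2_gt2 (T : finType) (J : {set {set T}}) :
  (forall x, x \in J -> #|x| = 2)%N -> (2 <= #|J|)%N -> (2 < #|cover J|)%N.
Proof.
move=> J2 /card_gt1P[x [y [xJ yJ xy]]]; rewrite ltnNge; apply/negP => le2.
have sub z : z \in J -> z = cover J.
  move=> zJ; apply/eqP; rewrite eqEcard (J2 z zJ) le2 andbT.
  by apply/subsetP => t tz; apply/bigcupP; exists z.
by move: xy; rewrite (sub x xJ) (sub y yJ) eqxx.
Qed.

Section Embeddings.
Variables (R : realFieldType) (V : finType) (n : nat).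
Implicit Types (phi : {ffun V -> 'I_n}) (J D : {set {set V}}).
Implicit Types (U G : {set {set 'I_n}}).

Definition img phi D : {set {set 'I_n}} := [set phi @: (x : {set V}) | x in D].

Lemma img_imset phi D (x : {set V}) : x \in D -> phi @: x \in img phi D.
Proof. by move=> xD; apply/imsetP; exists x. Qed.

Lemma subset_img phi D U :
  (img phi D \subset U) = [forall x in D, phi @: x \in U].
Proof.
apply/subsetP/forall_inP => [sub x xD|sub y /imsetP[x xD ->]]; last exact: sub.
exact/sub/img_imset.
Qed.

Lemma card_maps (A : {set V}) (D : {set 'I_n}) :
  (#|[set phi : {ffun V -> 'I_n} | [forall x in A, phi x \in D]]| =
   #|D| ^ #|A| * n ^ (#|V| - #|A|))%N.
Proof.
pose F x : pred 'I_n := fun y => (x \in A) ==> (y \in D).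
have -> : #|[set phi : {ffun V -> 'I_n} | [forall x in A, phi x \in D]]| = #|family F|.
  apply: eq_card => phi; rewrite inE; apply/forall_inP/familyP => [h x|h x xA].
    by rewrite unfold_in /F; apply/implyP/h.
  by have := h x; rewrite unfold_in /F xA.
rewrite card_family foldrE big_map big_enum /= (bigID (fun x => x \in A)) /=.
congr (_ * _)%N.
  rewrite (eq_bigr (fun=> #|D|)) ?prod_nat_const // => x xA.
  by apply: eq_card => y; rewrite unfold_in /F xA.
rewrite (eq_bigr (fun=> n)) => [|x /negbTE xA].
  rewrite prod_nat_const; congr (_ ^ _)%N.
  by rewrite -(cardC A) addKn; apply: eq_card.
by rewrite -[RHS]card_ord; apply: eq_card => y; rewrite unfold_in /F xA.
Qed.

Variable q : R.
Hypotheses (q0 : 0 < q) (q1 : q <= 1).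

(** Sort the maps by the set [J] of edges that they send into [U]. By injectivity every map in the
    class of [J] has weight [q ^+ (#|D| - #|J|)], and there are [2 ^+ #|D|] classes. *)
Lemma sum_weight_split (P : pred {ffun V -> 'I_n}) D U (C : R) :
  (forall phi, P phi -> injective phi) ->
  (forall J, J \subset D ->
    #|[set phi : {ffun V -> 'I_n} | P phi & img phi J \subset U]|%:R * q ^+ (#|D| - #|J|) <= C) ->
  \sum_(phi | P phi) q ^+ #|img phi D :\: U| <= 2 ^+ #|D| * C.
Proof.
move=> injP bound.
pose tr phi := [set x in D | phi @: x \in U].
rewrite (partition_big tr (fun J => J \subset D)) /=; last first.
  by move=> phi _; apply/subsetP => x; rewrite inE => /andP[].
have -> : 2 ^+ #|D| * C = \sum_(J : {set {set V}} | J \subset D) C.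
  rewrite sumr_const -natrX mulr_natl; congr (_ *+ _).
  by rewrite -(card_powerset D); apply: eq_card => J; rewrite powersetE.
apply: ler_sum => J JD; apply: le_trans (bound J JD).
rewrite -sum1_card natr_sum mulr_suml big_mkcond [leRHS]big_mkcond /=.
apply: ler_sum => phi _; case: ifPn => [/andP[Pphi /eqP trJ]|_]; last first.
  by case: ifP => //; rewrite mul1r exprn_ge0 // ltW.
have iphi := imset_inj (injP _ Pphi).
rewrite inE Pphi /= subset_img mul1r -trJ.
case: ifPn => [_|/negP[]]; last by apply/forall_inP => x; rewrite inE => /andP[].
suff -> : img phi D :\: U = img phi (D :\: tr phi).
  rewrite card_imset // cardsD (setIidPr _) //.
  by apply/subsetP => x; rewrite inE => /andP[].
apply/setP => y; rewrite !inE; apply/andP/imsetP => [[yU /imsetP[x xD yx]]|[x]].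
  by exists x => //; rewrite !inE xD /= andbT -yx.
rewrite !inE => /andP[+ xD] ->; rewrite xD /= => ->; split=> //.
exact: img_imset.
Qed.

Section Edges.
Variables (E : {set {set V}}) (r' : nat) (lam : R).
Hypothesis E2 : forall x, x \in E -> #|x| = 2%N.
Hypothesis lam0 : 0 < lam.
Local Notation v := #|V|.
Local Notation e := #|E|.

(** Up to constants, the expected number of extensions: [f0] goes onto a given pair, the other
    vertices are free, and [#|J| - 1] edges must lie in [G]. The 4 bounds the maps from [f0] into
    the pair, and [2 ^+ e] bounds the number of classes in [sum_weight_split]. *)
Definition ext_bound J : R := 2 ^+ e * (4 * n%:R ^+ (v - 2) * q ^+ (#|J| - 1)).

(** The maps are defined on all of [V], whence the power [v - 2] of [n] in [ext_bound] whatever [J]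
    is. *)
Definition extensions J (f0 : {set V}) (f : {set 'I_n}) G :=
  [set phi : {ffun V -> 'I_n} | injectiveb phi && (phi @: f0 == f)
     & img phi (J :\ f0) \subset G].

(* No pair has many more extensions to a copy of a proper subgraph than expected. *)
Definition good G : bool :=
  [forall J : {set {set V}}, forall f0 : {set V}, forall f : {set 'I_n},
    [&& J \proper E, f0 \in J & #|f| == 2%N] ==>
      (#|extensions J f0 f G|%:R <= lam * ext_bound J)].

Lemma imset_card2 phi (x : {set V}) : injective phi -> x \in E -> #|phi @: x| = 2%N.
Proof. by move=> iphi xE; rewrite card_imset ?E2. Qed.

(** A moment of order [r']. Fixing the set [J'] of edges sent into [U] confines the vertices of [J']
    and [f0] to the few labels that occur in [U] and [f]. The density hypothesis, applied to [J']
    with [f0] added, pays for the number of ways to place them. *)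
Lemma Pr_extensions J (f0 : {set V}) (f : {set 'I_n}) :
  (0 < n)%N ->
  (forall J, J \subset E -> J != E -> (2 <= #|J|)%N ->
     (2 * (e * r') + 2)%:R ^+ v <= n%:R ^+ (#|cover J| - 2) * q ^+ (#|J| - 1)) ->
  J \subset E -> J != E -> f0 \in J -> #|f| = 2%N ->
  Pr q (fun G => lam * ext_bound J < #|extensions J f0 f G|%:R) <= lam ^- r'.
Proof.
move=> n0 bal JE JnE f0J f2.
have nR0 : 0 < n%:R :> R by rewrite ltr0n.
have M0 : 0 < ext_bound J.
  by rewrite !mulr_gt0 ?exprn_gt0.
pose P := fun phi : {ffun V -> 'I_n} => injectiveb phi && (phi @: f0 == f).
have injP phi : P phi -> injective phi by case/andP => /injectiveP.
have cardJ : #|J| = (#|J :\ f0|).+1 by rewrite (cardsD1 f0) f0J.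
have v2 : (2 <= v)%N by rewrite -(E2 (subsetP JE _ f0J)) max_card.
have := @Pr_moment R _ q (ltW q0) q1 _ P (fun phi => img phi (J :\ f0)) (fun=> true) e r' lam
   (ext_bound J) lam0 M0.
apply.
  move=> phi /injP iphi; rewrite card_imset; last exact: imset_inj.
  by apply: subset_leq_card; apply: subset_trans JE; rewrite subsetDl.
move=> U _ _ _ Ur.
apply: (@le_trans _ _ (2 ^+ #|J :\ f0| * (4 * n%:R ^+ (v - 2) * q ^+ (#|J| - 1)))); last first.
  rewrite ler_wpM2r ?mulr_ge0 ?exprn_ge0 ?ler0n ?(ltW q0) //.
  rewrite ler_weXn2l ?ler1n // subset_leq_card //.
  by apply: subset_trans JE; rewrite subsetDl.
apply: sum_weight_split => // J' J'J.
(* Only the pairs in [U] can be images of edges, and their cover is small. *)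
pose U' := [set u in U | #|u| == 2%N].
have U'2 x : x \in U' -> #|x| = 2%N by rewrite inE => /andP[_ /eqP].
have U'r : (#|U'| <= e * r')%N.
  by apply: leq_trans Ur; apply: subset_leq_card; apply/subsetP => x; rewrite inE => /andP[].
(* No edge goes into [U]: what remains is that [f0] lands in [f]. *)
have [->|[g gJ']] := set_0Vmem J'.
  rewrite cards0 subn0 cardJ subn1 /= ler_wpM2r ?exprn_ge0 ?ler0n ?(ltW q0) //.
  rewrite -natrX -natrM ler_nat.
  have -> : (4 * n ^ (v - 2) = #|f| ^ #|f0| * n ^ (v - #|f0|))%N.
    by rewrite f2 E2 // (subsetP JE).
  rewrite -card_maps; apply: subset_leq_card; apply/subsetP => phi; rewrite !inE.
  case/andP => /andP[_ /eqP phif] _; apply/forall_inP => x xf0.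
  by rewrite -phif imset_f.
pose J1 := f0 |: J'.
have f0J' : f0 \notin J' by apply/negP => /(subsetP J'J); rewrite !inE eqxx.
have J1E : J1 \subset E.
  rewrite subUset sub1set (subsetP JE) //=; apply: subset_trans J'J _.
  by apply: subset_trans JE; rewrite subsetDl.
have J12 : (2 <= #|J1|)%N.
  by rewrite cardsU1 f0J' /= add1n ltnS card_gt0; apply/set0Pn; exists g.
have J1nE : J1 != E.
  apply: contraNneq JnE => J1E'; rewrite eqEsubset JE -J1E' subUset sub1set f0J /=.
  by apply: subset_trans J'J _; rewrite subsetDl.
have J1J : (#|J1| <= #|J|)%N.
  apply: subset_leq_card; rewrite subUset sub1set f0J; apply: subset_trans J'J _.
  by rewrite subsetDl.
have J1e x : x \in J1 -> #|x| = 2%N by move/(subsetP J1E)/E2.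
have cv := cover2_gt2 J1e J12.
have cvv : (#|cover J1| <= v)%N by rewrite max_card.
pose D := cover U' :|: f.
have Dle : (#|D| <= 2 * (e * r') + 2)%N.
  apply: leq_trans (leq_card_setU _ _) _; rewrite f2 leq_add2r.
  by apply: leq_trans (card_cover2 U'2) _; rewrite leq_mul2l.
(* Vertices covered by [J1] go into [D], the others anywhere. *)
have cnt : (#|[set phi : {ffun V -> 'I_n} | P phi & img phi J' \subset U]| <=
    (2 * (e * r') + 2) ^ v * n ^ (v - #|cover J1|))%N.
  apply: (@leq_trans (#|D| ^ #|cover J1| * n ^ (v - #|cover J1|))%N); last first.
    rewrite leq_mul2r; apply/orP; right.
    apply: (@leq_trans ((2 * (e * r') + 2) ^ #|cover J1|)%N).
      by rewrite leq_exp2r // (leq_trans _ cv).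
    by rewrite leq_pexp2l // addn2.
  rewrite -card_maps; apply: subset_leq_card; apply/subsetP => phi.
  rewrite !inE subset_img => /andP[Pphi /forall_inP J'U].
  apply/forall_inP => x /bigcupP[y yJ1 xy]; rewrite inE.
  case/setU1P: yJ1 => [yf0|yJ'].
    by case/andP: Pphi => _ /eqP <-; rewrite -yf0 imset_f ?orbT.
  apply/orP; left; apply/bigcupP; exists (phi @: y); last exact: imset_f.
  rewrite inE J'U //= imset_card2 ?eqxx //; first exact: injP.
  by apply: (subsetP J1E); rewrite setU1r.
have cJ1 : #|J1| = #|J'|.+1 by rewrite cardsU1 f0J'.
have -> : (#|J :\ f0| - #|J'| = #|J| - #|J1|)%N by rewrite cJ1 cardJ subSS.
apply: (@le_trans _ _ (((2 * (e * r') + 2) ^ v * n ^ (v - #|cover J1|))%:R * q ^+ (#|J| - #|J1|))).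
  by rewrite ler_wpM2r ?exprn_ge0 ?ler0n ?(ltW q0) // ler_nat.
rewrite natrM !natrX.
apply: (@le_trans _ _ (n%:R ^+ (#|cover J1| - 2) * q ^+ (#|J1| - 1) *
    n%:R ^+ (v - #|cover J1|) * q ^+ (#|J| - #|J1|))).
  rewrite ler_wpM2r ?exprn_ge0 ?ler0n ?(ltW q0) // ler_wpM2r ?exprn_ge0 ?ler0n ?(ltW q0) //.
  exact: bal.
have -> : (v - 2 = #|cover J1| - 2 + (v - #|cover J1|))%N.
  by move: cv cvv; clear; lia.
have -> : (#|J| - 1 = #|J1| - 1 + (#|J| - #|J1|))%N.
  by move: J12 J1J; clear; lia.
rewrite !exprD; set a := n%:R ^+ _; set b := n%:R ^+ _; set c := q ^+ _; set d := q ^+ _.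
have : 0 <= a * b * (c * d) by rewrite !mulr_ge0 ?exprn_ge0 ?ler0n ?ltW.
by nra.
Qed.

(** Union bound over the triples [(J, f0, f)]: at most [2 ^ e] choices for [J], [e] for [f0] and
    [n ^ 2] for [f]. *)
Lemma Pr_not_good :
  (0 < n)%N ->
  (forall J, J \subset E -> J != E -> (2 <= #|J|)%N ->
     (2 * (e * r') + 2)%:R ^+ v <= n%:R ^+ (#|cover J| - 2) * q ^+ (#|J| - 1)) ->
  Pr q (fun G => ~~ good G) <= (2 ^ e * e * n ^ 2)%:R * lam ^- r'.
Proof.
move=> n0 bal.
pose D := fun t : {set {set V}} * {set V} * {set 'I_n} =>
  [&& t.1.1 \proper E, t.1.2 \in t.1.1 & #|t.2| == 2%N].
pose P t G := lam * ext_bound t.1.1 < #|@extensions t.1.1 t.1.2 t.2 G|%:R.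
apply: (@le_trans _ _ (#|D|%:R * lam ^- r')).
  apply: le_trans (@Pr_exists _ _ _ (ltW q0) q1 _ D P (lam ^- r') _); last first.
    move=> [[J f0] f] /and3P[/= Jp f0J /eqP f2]; apply: Pr_extensions => //.
      exact: proper_sub.
    by move: Jp; rewrite properEneq => /andP[].
  apply: Pr_le; rewrite ?(ltW q0) // => G.
  rewrite negb_forall => /existsP[J]; rewrite negb_forall => /existsP[f0].
  rewrite negb_forall => /existsP[f]; rewrite negb_imply -ltNge => /andP[d lt].
  by apply/existsP; exists (J, f0, f); rewrite /= /P lt andbT.
rewrite ler_wpM2r ?invr_ge0 ?exprn_ge0 ?(ltW lam0) // ler_nat.
pose S := setX (setX (powerset E) E) [set f : {set 'I_n} | #|f| == 2%N].
apply: (@leq_trans #|S|).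
  apply: subset_leq_card; apply/subsetP => -[[J f0] f] /and3P[/= Jp f0J f2].
  have JE := proper_sub Jp.
  by rewrite !inE /= JE (subsetP JE).
rewrite !cardsX card_powerset leq_mul2l card_draws card_ord; apply/orP; right.
by rewrite bin2 -divn2 (leq_trans (leq_div _ _)) // leq_mul2l leq_pred orbT.
Qed.

(** The first term is the expected number, up to constants, of copies of [E] minus an edge whose
    missing pair lies in a given set of [k] labels. The second bounds the copies with an edge in a
    set of at most [e * r] pairs: choose that pair, then use [good] for its extensions. *)
Definition closed_bound (k r : nat) : R :=
  2 ^+ e * (k%:R ^+ 2 * n%:R ^+ (v - 2) * q ^+ (e - 1) +
    (e * r)%:R * (lam * 2 ^+ e * 4) * n%:R ^+ (v - 2) * q ^+ (e - 2)).

(** A moment of order [r] on the event [good]. The copies with no edge in [U] are counted directly.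
    In any other copy some edge [f0] lands on a pair of [U], and [U] lies in a good set. The edges
    sent into [U] omit [g], so they form a proper subset of [E], to which [good] applies. *)
Lemma Pr_closed (W : {set 'I_n}) (g : {set V}) (r : nat) :
  (0 < n)%N -> (2 <= e)%N -> g \in E -> (0 < #|W|)%N ->
  Pr q (fun G => good G && (lam * closed_bound #|W| r < #|[set phi : {ffun V -> 'I_n} |
      injectiveb phi && (phi @: g \subset W) & img phi (E :\ g) \subset G]|%:R))
    <= lam ^- r.
Proof.
move=> n0 e2 gE W0; set M := closed_bound _ _.
have nR0 : 0 < n%:R :> R by rewrite ltr0n.
have WR0 : 0 < #|W|%:R :> R by rewrite ltr0n.
have A0 : 0 < #|W|%:R ^+ 2 * n%:R ^+ (v - 2) * q ^+ (e - 1).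
  by rewrite !mulr_gt0 ?exprn_gt0.
have B0 : 0 <= (e * r)%:R * (lam * 2 ^+ e * 4) * n%:R ^+ (v - 2) * q ^+ (e - 2).
  by rewrite !mulr_ge0 ?exprn_ge0 ?ler0n ?(ltW lam0) ?(ltW q0).
have C0 := ltr_pwDl A0 B0.
have M0 : 0 < M by rewrite mulr_gt0 ?exprn_gt0.
pose P := fun phi : {ffun V -> 'I_n} => injectiveb phi && (phi @: g \subset W).
have injP phi : P phi -> injective phi by case/andP => /injectiveP.
have cardE : e = (#|E :\ g|).+1 by rewrite (cardsD1 g) gE.
apply: (@Pr_moment R _ q (ltW q0) q1 _ P (fun phi => img phi (E :\ g)) good e r lam M) => //.
  move=> phi /injP iphi; rewrite card_imset; last exact: imset_inj.
  by rewrite subset_leq_card // subsetDl.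
move=> U G UG gG Ur.
apply: (@le_trans _ _ (2 ^+ #|E :\ g| *
   (#|W|%:R ^+ 2 * n%:R ^+ (v - 2) * q ^+ (e - 1) +
     (e * r)%:R * (lam * 2 ^+ e * 4) * n%:R ^+ (v - 2) * q ^+ (e - 2)))); last first.
  by rewrite ler_wpM2r ?(ltW C0) // ler_weXn2l ?ler1n // subset_leq_card // subsetDl.
apply: sum_weight_split => // J JE.
have JEE : J \subset E by apply: subset_trans JE _; rewrite subsetDl.
have [->|[f0 f0J]] := set_0Vmem J.
  apply: (@le_trans _ _ (#|W|%:R ^+ 2 * n%:R ^+ (v - 2) * q ^+ (e - 1))); last by rewrite lerDl.
  have -> : (#|E :\ g| - #|@set0 {set V}| = e - 1)%N by rewrite cards0 subn0 cardE subn1.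
  rewrite ler_wpM2r ?exprn_ge0 ?ler0n ?(ltW q0) //.
  rewrite -!natrX -natrM ler_nat -{1}(E2 gE) -(E2 gE) -card_maps.
  apply: subset_leq_card; apply/subsetP => phi; rewrite !inE.
  case/andP => /andP[_ /subsetP phiW] _; apply/forall_inP => x xg.
  by apply: phiW; rewrite imset_f.
apply: (@le_trans _ _ ((e * r)%:R * (lam * 2 ^+ e * 4) * n%:R ^+ (v - 2) * q ^+ (e - 2)));
  last by rewrite lerDr (ltW A0).
have f0E := subsetP JEE _ f0J.
have Jp : J \proper E.
  rewrite properEneq JEE andbT; apply: contraTneq gE => <-.
  by apply/negP => /(subsetP JE); rewrite !inE eqxx.
pose U' := [set u in U | #|u| == 2%N].
have U'r : (#|U'| <= e * r)%N.
  by apply: leq_trans Ur; apply: subset_leq_card; apply/subsetP => x; rewrite inE => /andP[].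
have cnt : #|[set phi : {ffun V -> 'I_n} | P phi & img phi J \subset U]|%:R <=
    (e * r)%:R * (lam * ext_bound J).
  apply: (@le_trans _ _ (\sum_(f in U') #|extensions J f0 f G|)%:R).
    rewrite ler_nat; apply: (@leq_trans #|\bigcup_(f in U') extensions J f0 f G|);
      last exact: leq_card_bigcup.
    apply: subset_leq_card; apply/subsetP => phi.
    rewrite inE subset_img => /andP[Pphi /forall_inP JU].
    apply/bigcupP; exists (phi @: f0).
      by rewrite inE JU //= imset_card2 ?eqxx //; exact: injP.
    rewrite inE eqxx andbT; apply/andP; split; first by case/andP: Pphi.
    rewrite subset_img; apply/forall_inP => x; rewrite !inE => /andP[_ xJ].
    by apply: (subsetP UG); exact: JU.
  rewrite natr_sum; apply: (@le_trans _ _ (\sum_(f in U') lam * ext_bound J)).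
    apply: ler_sum => f; rewrite inE => /andP[_ f2].
    have /forallP/(_ J)/forallP/(_ f0)/forallP/(_ f)/implyP := gG.
    by apply; rewrite Jp f0J.
  rewrite sumr_const -[leLHS]mulr_natl ler_wpM2r ?ler_nat //.
  by rewrite !mulr_ge0 ?exprn_ge0 ?ler0n ?(ltW lam0) ?(ltW q0).
apply: (@le_trans _ _ ((e * r)%:R * (lam * ext_bound J) * q ^+ (#|E :\ g| - #|J|))).
  by rewrite ler_wpM2r ?exprn_ge0 ?(ltW q0).
(* The power of [q] is the same for all [J]: [ext_bound] supplies [#|J| - 1], the edges not sent
   into [U] the rest. *)
have -> : (e - 2 = (#|J| - 1) + (#|E :\ g| - #|J|))%N.
  have : (0 < #|J|)%N by apply/card_gt0P; exists f0.
  by move: (subset_leq_card JE) cardE; clear; lia.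
rewrite exprD /ext_bound; set a := 2 ^+ _; set b := n%:R ^+ _; set c := q ^+ _; set d := q ^+ _.
by rewrite le_eqVlt; apply/orP; left; apply/eqP; ring.
Qed.

End Edges.
End Embeddings.

(** * The game *)

Section Game.
Local Open Scope nat_scope.
Variables (V : finType) (E : {set {set V}}) (d n : nat).
Hypothesis d0 : 0 < d.
Implicit Types (h : history) (u : nat) (G : {set {set 'I_n.+1}}) (W : {set 'I_n.+1}).

Definition incident u (x : (nat * nat) * color) := (u == x.1.1) || (u == x.1.2).
Definition other u (x : (nat * nat) * color) := if u == x.1.1 then x.1.2 else x.1.1.
Definition deg h u := count (incident u) h.
(** A promoted vertex is appended at the end, so that positions in the list, which serve as labels,
    never change. *)
Definition promote h (s : seq nat) u :=
  if (u \in s) || (deg h u < d) then s else rcons s u.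
Fixpoint high h : seq nat :=
  if h is x :: h' then promote h (promote h (high h') x.1.1) x.1.2 else [::].
(** [index] and [inord] also return a value for unlisted vertices and for positions beyond [n]. A
    label is meaningful only for a vertex of [high h], while this list has at most [n.+1]
    entries. *)
Definition label h u : 'I_n.+1 := inord (index u (high h)).
Definition lpair h (e : nat * nat) : {set 'I_n.+1} := [set label h e.1; label h e.2].
Definition both_high h (e : nat * nat) := (e.1 \in high h) && (e.2 \in high h).
Definition red_copy h := exists f : V -> nat, injective f /\
  forall x y, [set x; y] \in E -> colored h red (f x) (f y).
Definition closing h (e : nat * nat) : bool := `[< red_copy ((e, red) :: h) >].

Definition painter G : painter_strategy :=
  fun h e => [&& both_high h e, lpair h e \in G & ~~ closing h e].

Lemma mem_promote h s u z :
  (z \in promote h s u) = (z \in s) || ((z == u) && (d <= deg h u)).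
Proof.
rewrite /promote ltnNge; case: (boolP (u \in s)) => [us|us] /=.
  by case: eqVneq => [->|_]; rewrite ?us ?orbF ?orTb ?andFb ?orbF.
case: (d <= deg h u); rewrite ?andbF ?orbF ?andbT //=.
by rewrite mem_rcons inE orbC.
Qed.

Lemma index_promote h s u z : z \in s -> index z (promote h s u) = index z s.
Proof.
by move=> zs; rewrite /promote; case: ifP => // _; rewrite -cats1 index_cat zs.
Qed.

Lemma uniq_promote h s u : uniq s -> uniq (promote h s u).
Proof.
by move=> us; rewrite /promote; case: ifPn => //; rewrite negb_or rcons_uniq us andbT => /andP[].
Qed.

Lemma deg_cons x h u : deg (x :: h) u = incident u x + deg h u.
Proof. by []. Qed.

(** A move changes the degrees of its two ends only, and both are offered for promotion at once;
    [d0] settles the empty history. *)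
Lemma mem_high h u : (u \in high h) = (d <= deg h u).
Proof.
elim: h u => [|x h IHh] u; first by rewrite leqn0 (gtn_eqF d0).
rewrite [high _]/= !mem_promote IHh !deg_cons /incident.
case: (eqVneq u x.1.1) => [->|n1] /=.
  by rewrite eqxx; case: (eqVneq x.1.1 x.1.2) => [->|_]; rewrite ?eqxx ?orbT /=; lia.
case: (eqVneq u x.1.2) => [->|n2] /=; last by rewrite !orbF.
by rewrite eqxx orbT /=; lia.
Qed.

Lemma uniq_high h : uniq (high h).
Proof. by elim: h => //= x h IHh; do 2!apply: uniq_promote. Qed.

Lemma sum_deg h (s : seq nat) : uniq s -> \sum_(u <- s) deg h u <= 2 * size h.
Proof.
have one y (t : seq nat) : uniq t -> \sum_(u <- t) (u == y :> nat) <= 1.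
  move=> ut; have -> : \sum_(u <- t) (u == y :> nat) = count_mem y t.
    by rewrite -sumn_count sumnE big_map.
  by rewrite count_uniq_mem // leq_b1.
move=> us; elim: h => [|x h IHh]; first by rewrite big1.
under eq_bigr do rewrite deg_cons.
rewrite big_split /= mulnS leq_add //.
apply: (@leq_trans (\sum_(u <- s) ((u == x.1.1) + (u == x.1.2)))).
  by apply: leq_sum => u _; rewrite /incident; do 2!case: (_ == _).
by rewrite big_split (leq_add (one x.1.1 s us) (one x.1.2 s us)).
Qed.

(** Degree count; it limits the number of labels used after a given number of turns. *)
Lemma size_high h : d * size (high h) <= 2 * size h.
Proof.
apply: leq_trans (sum_deg h (uniq_high h)).
rewrite mulnC -sum1_size big_distrl /= big_seq_cond [leqRHS]big_seq_cond.
by apply: leq_sum => u; rewrite andbT mem_high mul1n.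
Qed.

Lemma high_cat s h u : u \in high h ->
  u \in high (s ++ h) /\ index u (high (s ++ h)) = index u (high h).
Proof.
move=> uh; elim: s => [|x s [IHm IHi]] //=.
have m1 : u \in promote (x :: s ++ h) (high (s ++ h)) x.1.1 by rewrite mem_promote IHm.
by split; [rewrite mem_promote m1 | rewrite index_promote // index_promote].
Qed.

Lemma label_cat s h u : u \in high h -> label (s ++ h) u = label h u.
Proof. by rewrite /label => /high_cat-/(_ s)[_ ->]. Qed.

Lemma lpair_cat s h e : both_high h e -> lpair (s ++ h) e = lpair h e.
Proof. by case/andP => h1 h2; rewrite /lpair !label_cat. Qed.

Lemma label_inj h u u' : size (high h) <= n.+1 -> u \in high h -> u' \in high h ->
  label h u = label h u' -> u = u'.
Proof.
move=> sz uh u'h /(congr1 val) /=.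
rewrite !inordK ?(leq_trans _ sz) ?index_mem // => /(congr1 (nth 0 (high h))).
by rewrite !nth_index.
Qed.

Lemma size_play b p N : size (play b p N) = N.
Proof. by elim: N => //= N ->. Qed.

(** Every suffix of a play is the position at an earlier turn, so the circumstances of each move can
    be recovered. *)
Lemma play_step b p N s e c h : play b p N = s ++ (e, c) :: h ->
  [/\ h = play b p (size h), e = b h & c = p h e].
Proof.
elim: N s => [|N IHN] [|x s] //= [].
- by move=> <- <- <-; rewrite size_play; split.
- by move=> _ /IHN.
Qed.

Lemma mem_split (x : (nat * nat) * color) h : x \in h -> exists s h', h = s ++ x :: h'.
Proof. by move=> /splitPr[s h']; exists s, h'. Qed.

Lemma colored_split c h u v : colored h c u v ->
  exists s e h', h = s ++ (e, c) :: h' /\ (e = (u, v) \/ e = (v, u)).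
Proof.
by case/orP => /mem_split[s [h' ->]];
  [exists s, (u, v), h'; split; [|left]|exists s, (v, u), h'; split; [|right]].
Qed.

Lemma colored_cons e c h c' u v : colored ((e, c) :: h) c' u v ->
  colored h c' u v \/ c' = c /\ (e = (u, v) \/ e = (v, u)).
Proof.
rewrite /colored !inE -orbA => /or4P[/eqP[<- ->]|->|/eqP[<- ->]|->]; rewrite ?orbT; auto.
Qed.

Lemma colored_cat s h c u v : colored h c u v -> colored (s ++ h) c u v.
Proof. by rewrite /colored !mem_cat => /orP[] ->; rewrite ?orbT. Qed.

(** A legal Builder never repeats a pair, so no pair gets two colors. *)
Lemma red_blueF b p N u v : legal b ->
  colored (play b p N) red u v -> colored (play b p N) blue u v -> False.
Proof.
move=> lb; elim: N => //= N IHN; set h := play b p N in IHN *.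
have /andP[_] := lb h; rewrite /placed negb_or => /andP[npr npb] r' b'.
have nc c : colored h c (b h).1 (b h).2 -> False.
  by case: c => cl; [rewrite cl in npr|rewrite cl in npb].
have nc' c : (b h = (u, v) \/ b h = (v, u)) -> colored h c u v -> False.
  by move=> [] eb; [|rewrite coloredC]; have := @nc c; rewrite eb.
case: (colored_cons r') => [r1|[r1 r2]]; case: (colored_cons b') => [b1|[b1 b2]].
- exact: IHN.
- exact: nc' b2 r1.
- exact: nc' r2 b1.
- by move: b1; rewrite -r1.
Qed.

Lemma deg_ge h u (s : seq nat) : uniq s ->
  (forall y, y \in s -> exists c, colored h c u y) -> size s <= deg h u.
Proof.
move=> us sh; rewrite /deg -size_filter -(size_map (other u)).
apply: uniq_leq_size => // y /sh[c /orP[]] yh; apply/mapP.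
  by exists ((u, y), c); rewrite ?mem_filter /incident /other /= ?eqxx.
exists ((y, u), c); rewrite ?mem_filter /incident /other /= ?eqxx ?orbT //.
by case: eqP.
Qed.

(** The painter answers these edges blue whatever [G] is; they are a loss of at most [d] per vertex
    in the count of clique edges. *)
Fixpoint low h u : seq nat :=
  if h is x :: h' then
    if incident u x && (u \notin high h') then other u x :: low h' u else low h' u
  else [::].

(** A neighbour is recorded only while the degree is below [d]; the minimum with the degree carries
    the induction. *)
Lemma size_low h u : size (low h u) <= minn d (deg h u).
Proof.
elim: h => // x h IHh; rewrite [low _ _]/= deg_cons mem_high -ltnNge.
by case: ifPn => /=; case: (incident u x) => /=; lia.
Qed.

Lemma low_cat s x h u : incident u x -> u \notin high h -> other u x \in low (s ++ x :: h) u.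
Proof.
move=> ux uh; elim: s => [|y s IHs] /=; first by rewrite ux uh inE eqxx.
by case: ifP => //; rewrite inE IHs orbT.
Qed.

(** * Red copies, queried pairs and blue cliques *)

Hypothesis E2 : forall x, x \in E -> #|x| = 2.
Hypothesis EV : cover E = [set: V].
Hypothesis E0 : E != set0.

Lemma no_red_copy b G N : ~ red_copy (play b (painter G) N).
Proof.
elim: N => [|N IHN] /=.
  case=> f [_ /=]; have [x xE] := set0Pn _ E0.
  have /eqP/cards2P[y [z [_ xyz]]] := E2 xE.
  by rewrite xyz in xE => /(_ _ _ xE).
case def: (painter G _ _).
  move=> rc; move: def; rewrite /painter => /and3P[_ _ /negP]; apply.
  exact/asboolP.
case=> f [finj fE]; apply: IHN; exists f; split=> // x y /fE fxy.
by case: (colored_cons fxy) => [//|[]].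
Qed.

Lemma red_high b G N u v : let h := play b (painter G) N in
  colored h red u v -> [/\ u \in high h, v \in high h & [set label h u; label h v] \in G].
Proof.
move=> h /colored_split[s [e [h' [hE euv]]]].
have [_ _ /esym] := play_step hE; rewrite /painter => /and3P[bh eG _].
rewrite hE -cat_rcons; move: (bh).
case/andP => /(high_cat (rcons s (e, red)))[e1 _] /(high_cat (rcons s (e,red)))[e2 _].
move: eG; rewrite -(lpair_cat (rcons s (e, red)) bh) /lpair.
by case: euv e1 e2 => -> /= e1 e2 => [|] eG; split=> //; rewrite setUC.
Qed.

Lemma edge_color (f : V -> nat) h : 
  ~ (forall x y, [set x; y] \in E -> colored h red (f x) (f y)) ->
  exists x y, [set x; y] \in E /\ ~~ colored h red (f x) (f y).
Proof.
move=> nf; apply: contrapT => nex; apply: nf => x y xy.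
by apply: contrapT => /negP nc; apply: nex; exists x, y.
Qed.

(** No red copy existed before, so [e] is the image of some edge [g]. All other edges of the copy
    are red, hence have labelled ends and a pair of labels in [G]. As the edges cover [V], every
    vertex of the copy is labelled, and passing to labels gives [phi]. *)
Lemma closing_copy b G N e : let h := play b (painter G) N in
  size (high h) <= n.+1 -> both_high h e -> closing h e ->
  exists2 g, g \in E & exists phi : {ffun V -> 'I_n.+1},
    [/\ injective phi, phi @: g = lpair h e & img phi (E :\ g) \subset G].
Proof.
move=> h sz bh /asboolP[f [finj fE]].
have [x [y [xyE nxy]]] : exists x y, [set x; y] \in E /\ ~~ colored h red (f x) (f y).
  by apply: edge_color => fE'; apply: (@no_red_copy b G N); exists f.
have exy : e = (f x, f y) \/ e = (f y, f x).
  by case: (colored_cons (fE _ _ xyE)) => [c|[_ //]]; rewrite c in nxy.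
have edge2 w z : w \in E -> z \in w -> exists2 t, w = [set z; t] & t \in w.
  move=> wE zw; have /eqP/cards2P[a [c [ac wac]]] := E2 wE.
  rewrite wac in zw *; case/set2P: zw => ->; [exists c | exists a] => //;
  by rewrite ?set21 ?set22 // setUC.
have fhigh z : f z \in high h.
  have : z \in cover E by rewrite EV inE.
  case/bigcupP => w wE zw; have [t wzt _] := edge2 w z wE zw.
  rewrite wzt in wE; case: (colored_cons (fE _ _ wE)) => [|[_ ezt]].
    by case/red_high.
  by case: ezt bh => -> /andP[].
pose phi := [ffun z => label h (f z)].
have phiE z t : phi @: [set z; t] = [set label h (f z); label h (f t)].
  by rewrite imsetU1 imset_set1 !ffunE.
exists [set x; y] => //; exists phi; split.
- by move=> z t; rewrite !ffunE => /(label_inj sz (fhigh z) (fhigh t))/finj.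
- by rewrite phiE /lpair; case: exy => -> //=; rewrite setUC.
rewrite subset_img; apply/forall_inP => w; rewrite !inE => /andP[wxy wE].
have /eqP/cards2P[s [t [_ wst]]] := E2 wE; rewrite wst in wE wxy *.
rewrite phiE; case: (colored_cons (fE _ _ wE)) => [/red_high[]//|[_ est]].
case/eqP: wxy; have inj2 a c a' c' : (f a, f c) = (f a', f c') -> a = a' /\ c = c'.
  by case=> /finj-> /finj->.
case: est exy => -> [] /inj2[-> ->] //; exact: setUC.
Qed.

(** On these pairs membership in [G] alone decided the color. *)
Fixpoint queried h : {set {set 'I_n.+1}} :=
  if h is x :: h' then
    (if both_high h' x.1 && ~~ closing h' x.1 then [set lpair h' x.1] else set0)
      :|: queried h'
  else set0.

Lemma mem_queried h t : t \in queried h -> exists s x h',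
  [/\ h = s ++ x :: h', both_high h' x.1, ~~ closing h' x.1 & t = lpair h' x.1].
Proof.
elim: h => [|x h IHh] /=; first by rewrite inE.
case/setUP => [|/IHh[s [y [h' [-> bh cl te]]]]].
  case: ifP => [/andP[bh cl]|]; rewrite inE // => /eqP te.
  by exists [::], x, h.
by exists (x :: s), y, h'.
Qed.

Lemma queried_cat s x h : both_high h x.1 -> ~~ closing h x.1 ->
  lpair h x.1 \in queried (s ++ x :: h).
Proof.
move=> bh cl; elim: s => [|y s IHs] /=; first by rewrite bh cl !inE eqxx.
by rewrite inE IHs orbT.
Qed.

(** Removing the pairs inside [W] from [G] can only alter a red answer inside [W], and there is
    none. *)
Lemma play_avoid b G W N :
  (forall s e h, play b (painter G) N = s ++ (e, red) :: h -> ~~ (lpair h e \subset W)) ->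
  play b (painter (G :\: powerset W)) N = play b (painter G) N.
Proof.
elim: N => //= N IHN avoid.
have eqN : play b (painter (G :\: powerset W)) N = play b (painter G) N.
  by apply: IHN => s e h hE; apply: (avoid (_ :: s)); rewrite /= hE.
rewrite eqN; congr (_ :: _); congr (_, _); set h := play _ _ N.
case pG : (painter G h (b h)).
  have := avoid [::] (b h) h; rewrite pG => /(_ erefl) nW.
  by move: pG; rewrite /painter !inE nW.
move: pG; rewrite /painter !inE; case: (both_high _ _) => //=.
by case: (lpair _ _ \in G); case: (closing _ _); rewrite ?andbF.
Qed.

Definition closed_copies W G (g : {set V}) : {set {ffun V -> 'I_n.+1}} :=
  [set phi : {ffun V -> 'I_n.+1} | injectiveb phi && (phi @: g \subset W)
     & img phi (E :\ g) \subset G].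

(* Inside the label set of a blue clique the painter has always answered blue,
   so the same play arises from [G] with these pairs removed. *)
Lemma blue_clique b G N k (f : 'I_k -> nat) : let h := play b (painter G) N in
  legal b -> size (high h) <= n.+1 -> d < k -> injective f ->
  (forall i j, i != j -> colored h blue (f i) (f j)) ->
  exists W : {set 'I_n.+1},
    let Q := queried (play b (painter (G :\: powerset W)) N) :&: powerset W in
   [/\ #|W| = k, [disjoint G & Q] &
     'C(k, 2) <= #|Q| + k * d + \sum_(g in E) #|closed_copies W G g|].
Proof.
move=> h lb sz dk finj fblue.
(* A clique vertex has [k - 1 >= d] blue neighbours, hence a label at the end. *)
have fhigh i : f i \in high h.
  rewrite mem_high; apply: (@leq_trans (size [seq f j | j <- enum [set~ i]])).
    by rewrite size_map -cardE cardsC1 card_ord; lia.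
  apply: deg_ge; first by rewrite map_inj_uniq ?enum_uniq.
  move=> y /mapP[j]; rewrite mem_enum !inE => ij ->; exists blue.
  by apply: fblue; rewrite eq_sym.
pose L i := label h (f i).
have Linj : injective L by move=> i j /(label_inj sz (fhigh i) (fhigh j))/finj.
pose W := [set L i | i : 'I_k].
(* Labels are injective, so a labelled move inside [W] joins two clique vertices, whose edge is
   blue. *)
have step_pair s e c h' : h = s ++ (e, c) :: h' -> both_high h' e ->
    lpair h' e \subset W -> c = blue.
  move=> hE bh; rewrite -(lpair_cat (rcons s (e, c)) bh) cat_rcons -hE.
  rewrite subUset !sub1set => /andP[/imsetP[i _ ei] /imsetP[j _ ej]].
  move: (bh) => /andP[/(high_cat (rcons s (e, c)))[e1 _] /(high_cat (rcons s (e, c)))[e2 _]].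
  rewrite cat_rcons -hE in e1 e2.
  have {}ei := label_inj sz e1 (fhigh i) ei.
  have {}ej := label_inj sz e2 (fhigh j) ej.
  have [h'E eb _] := play_step hE.
  have ij : i != j.
    have /andP[+ _] := lb h'; rewrite -eb ei ej; apply: contraNneq => ->.
    by [].
  case: c hE => // hE; exfalso; apply: (@red_blueF b (painter G) N (f i) (f j) lb).
    rewrite -/h hE; apply: colored_cat; rewrite /colored -ei -ej -surjective_pairing.
    by rewrite inE eqxx.
  exact: fblue.
have eqplay : play b (painter (G :\: powerset W)) N = h.
  apply: play_avoid => s e h' hE; apply/negP => sub.
  have [_ _ /esym/and3P[bh _ _]] := play_step hE.
  by have := step_pair _ _ _ _ hE bh sub.
exists W; rewrite eqplay => Q; split.
- by rewrite card_imset // card_ord.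
- apply/pred0P => t; apply/negP => /andP[]; rewrite /= => tG.
  case/setIP => tQ; rewrite powersetE => tW.
  have [s [[e c] [h' [hE bh cl te]]]] := mem_queried tQ.
  have [_ _ cE] := play_step hE.
  have := step_pair _ _ _ _ hE bh; rewrite -te => /(_ tW).
  by rewrite cE /painter bh -te tG cl.
pose LA (A : {set 'I_k}) := L @: A.
have LAinj : injective LA by exact: imset_inj.
have LAW A : LA A \subset W by apply/subsetP => _ /imsetP[i _ ->]; apply: imset_f.
pose P2 := [set A : {set 'I_k} | #|A| == 2].
(* Three kinds of clique edges: decided by [G] alone ([A1]), placed while an end had no label
   ([A2]), blue because red would have closed a copy ([A3]). *)
pose A1 := [set A : {set 'I_k} | LA A \in Q].
pose A2 := \bigcup_(i : 'I_k) [set [set i; j] | j in [set j | f j \in low h (f i)]].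
pose A3 := [set A : {set 'I_k} |
  LA A \in \bigcup_(g in E) [set phi @: g | phi : {ffun V -> 'I_n.+1} in closed_copies W G g]].
have -> : 'C(k, 2) = #|P2| by rewrite card_draws card_ord.
have sub : P2 \subset A1 :|: A2 :|: A3.
  apply/subsetP => A; rewrite inE => /cards2P[i [j [ij ->]]] {A}.
  have LAE : LA [set i; j] = [set L i; L j] by rewrite /LA imsetU1 imset_set1.
  have [s [e [h' [hE eij]]]] := colored_split (fblue i j ij).
  have inA2 : forall i j, i != j -> e = (f i, f j) \/ e = (f j, f i) ->
      f i \notin high h' -> [set i; j] \in A2.
    move=> {ij eij LAE} i' j' ij eij ni; apply/bigcupP; exists i' => //; apply: imset_f.
    rewrite inE hE; have -> : f j' = other (f i') (e, blue).
      rewrite /other; case: eij => -> /=; first by rewrite eqxx.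
      by rewrite (inj_eq finj) (negbTE ij).
    apply: low_cat => //; rewrite /incident.
    by case: eij => -> /=; rewrite eqxx ?orbT.
  have [hi|ni] := boolP (f i \in high h'); last by rewrite !inE inA2 ?orbT.
  have [hj|nj] := boolP (f j \in high h'); last first.
    by rewrite !inE [[set i; j]]setUC inA2 ?orbT // 1?eq_sym //; case: eij; auto.
  have bh : both_high h' e by case: eij => ->; rewrite /both_high /= hi hj.
  have lpE : lpair h' e = LA [set i; j].
    rewrite LAE -(lpair_cat (rcons s (e, blue)) bh) cat_rcons -hE /lpair.
    by case: eij => -> //=; rewrite setUC.
  have [h'E _ _] := play_step hE.
  have [cl|ncl] := boolP (closing h' e); last first.
    rewrite !inE LAW andbT -lpE hE.
    by rewrite (queried_cat s (x := (e, blue)) bh ncl).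
  have sz' : size (high h') <= n.+1.
    apply: leq_trans sz; apply: uniq_leq_size; first exact: uniq_high.
    by move=> u /(high_cat (rcons s (e, blue)))[]; rewrite cat_rcons -hE.
  rewrite h'E in sz' bh cl; have [g gE [phi [iphi pg pG]]] := closing_copy sz' bh cl.
  rewrite -h'E in pg.
  rewrite !inE; apply/orP; right; apply/bigcupP; exists g => //.
  rewrite -lpE -pg; apply: imset_f; rewrite inE pG pg lpE LAW !andbT.
  exact/injectiveP.
apply: leq_trans (subset_leq_card sub) _.
apply: leq_trans (leq_card_setU _ _) _; apply: leq_add.
  apply: leq_trans (leq_card_setU _ _) _; apply: leq_add.
    rewrite -(card_imset _ LAinj); apply: subset_leq_card.
    by apply/subsetP => _ /imsetP[A AA ->]; rewrite inE in AA.
  apply: leq_trans (leq_card_bigcup _ _) _.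
  apply: (@leq_trans (\sum_(i < k) d)); last by rewrite sum_nat_const card_ord.
  apply: leq_sum => i _; apply: leq_trans (leq_imset_card _ _) _.
  apply: (@leq_trans (size (low h (f i)))); last by apply: leq_trans (size_low _ _) (geq_minl _ _).
  rewrite cardE -(size_map f); apply: uniq_leq_size.
    by rewrite map_inj_uniq ?enum_uniq.
  by move=> y /mapP[j]; rewrite mem_enum inE => + ->.
rewrite -(card_imset _ LAinj).
apply: (@leq_trans #|\bigcup_(g in E)
    [set phi @: g | phi : {ffun V -> 'I_n.+1} in closed_copies W G g]|).
  by apply: subset_leq_card; apply/subsetP => _ /imsetP[A AA ->]; rewrite inE in AA.
apply: leq_trans (leq_card_bigcup _ _) _; apply: leq_sum => g _; exact: leq_imset_card.
Qed.

End Game.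

(** * A union bound over the bad events *)

Lemma bin_leq_exp n k : ('C(n, k) <= n ^ k)%N.
Proof.
apply: (@leq_trans (n ^_ k)%N); first by rewrite -bin_ffact leq_pmulr ?fact_gt0.
elim: k => [|k IHk]; first by rewrite ffactn0.
by rewrite ffactnSr expnSr leq_mul // leq_subr.
Qed.

Section Wins.
Variables (R : realFieldType) (V : finType) (E : {set {set V}}).
Variables (k d n r r' l s : nat) (q lam : R).
Local Notation e := #|E|.
Hypothesis E2 : forall x, x \in E -> #|x| = 2%N.
Hypothesis EV : cover E = [set: V].
Hypotheses (e2 : (2 <= e)%N) (d0 : (0 < d)%N) (dk : (d < k)%N).
Hypotheses (q0 : 0 < q) (q1 : q <= 1) (lam0 : 0 < lam).
Hypothesis balanced : forall J : {set {set V}}, J \subset E -> J != E -> (2 <= #|J|)%N ->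
  (2 * (e * r') + 2)%:R ^+ #|V| <= n.+1%:R ^+ (#|cover J| - 2) * q ^+ (#|J| - 1) :> R.
Hypothesis bad1 : (2 ^ e * e * n.+1 ^ 2)%:R * lam ^- r' <= 1 / 4.
Hypothesis bad2 : (n.+1 ^ k * e)%:R * lam ^- r <= 1 / 4.
Hypothesis bad3 : (n.+1 ^ k)%:R * (1 - q) ^+ l <= 1 / 4.
Hypothesis closed_le : e%:R * (lam * closed_bound n.+1 q E lam k r) <= s%:R.
Hypothesis lks : (l + k * d + s <= 'C(k, 2))%N.

(** Builder's strategy is fixed first, so the play is a function of [G]. Three bad events have
    probability at most 1/4 each, and a set [G] outside them defines a winning painter: the edges of
    a blue clique would be too few by [lks]. The bound on [N] ensures that [n.+1] labels suffice. *)
Lemma painter_wins b N : legal b -> (2 * N <= d * n.+1)%N ->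
  exists p, ~ red_copy E (play b p N) /\ ~ has_copy (complete k) (colored (play b p N) blue).
Proof.
move=> lb Nle.
have n0 : (0 < n.+1)%N by [].
have E0 : E != set0 by rewrite -card_gt0 ltnW.
pose M := lam * closed_bound n.+1 q E lam k r.
pose Q (W : {set 'I_n.+1}) (A : {set {set 'I_n.+1}}) :=
  queried E d n (play b (painter E d A) N) :&: powerset W.
pose B1 (G : {set {set 'I_n.+1}}) := ~~ good q E lam G.
pose D2 (t : {set 'I_n.+1} * {set V}) := (#|t.1| == k) && (t.2 \in E).
pose B2 (G : {set {set 'I_n.+1}}) :=
  [exists (t | D2 t), good q E lam G && (M < #|closed_copies E t.1 G t.2|%:R)].
pose D3 (W : {set 'I_n.+1}) := #|W| == k.
pose B3 (G : {set {set 'I_n.+1}}) := [exists (W | D3 W), [disjoint G & Q W (G :\: powerset W)] &&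
  (l <= #|Q W (G :\: powerset W)|)%N].
have cD3 : (#|D3| <= n.+1 ^ k)%N.
  have -> : #|D3| = #|[set W : {set 'I_n.+1} | #|W| == k]| by apply: eq_card => W; rewrite inE.
  by rewrite card_draws card_ord bin_leq_exp.
have P1 : Pr q B1 <= 1 / 4.
  by apply: le_trans bad1; apply: Pr_not_good.
have P2 : Pr q B2 <= 1 / 4.
  apply: le_trans bad2; apply: le_trans (Pr_exists (ltW q0) q1 (x := lam ^- r) _) _.
    move=> [W g] /andP[/= /eqP Wk gE]; rewrite /M -Wk.
    by apply: Pr_closed => //; rewrite Wk (leq_trans _ dk).
  rewrite ler_wpM2r ?invr_ge0 ?exprn_ge0 ?(ltW lam0) // ler_nat.
  apply: (@leq_trans #|setX [set W : {set 'I_n.+1} | #|W| == k] E|).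
    by apply: subset_leq_card; apply/subsetP => -[W g]; rewrite !inE.
  by rewrite cardsX card_draws card_ord leq_mul2r bin_leq_exp orbT.
have P3 : Pr q B3 <= 1 / 4.
  apply: le_trans bad3; apply: le_trans (Pr_exists (ltW q0) q1 (x := (1 - q) ^+ l) _) _.
    move=> W _; apply: (@Pr_avoid _ _ q (ltW q0) q1 (powerset W) (Q W) l) => A.
    exact: subsetIr.
  by rewrite ler_wpM2r ?exprn_ge0 ?subr_ge0 // ler_nat.
have [G /and3P[G1 G2 G3]] : exists G, [&& ~~ B1 G, ~~ B2 G & ~~ B3 G].
  apply/existsP; apply/contraT; rewrite negb_exists => /forallP all_bad; exfalso.
  have : 1 <= Pr q B1 + Pr q B2 + Pr q B3.
    rewrite -(Pr_predT {set 'I_n.+1} q) /Pr [in leRHS]big_mkcond [X in _ + X + _]big_mkcond.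
    rewrite [X in _ + X]big_mkcond -!big_split /=; apply: ler_sum => G _.
    have := weight_ge0 (ltW q0) q1 G; have := all_bad G.
    by case: (B1 G); case: (B2 G); case: (B3 G) => //=; lra.
  lra.
exists (painter E d G); split; first exact: (no_red_copy E2 E0).
case=> f [finj fblue].
have sz : (size (high d (play b (painter E d G) N)) <= n.+1)%N.
  have := size_high d0 (play b (painter E d G) N); rewrite size_play => h.
  by rewrite -(leq_pmul2l d0) (leq_trans h).
have [W [Wk dis cnt]] := blue_clique d0 E2 EV E0 lb sz dk finj fblue.
have Ql : (#|Q W (G :\: powerset W)| < l)%N.
  rewrite ltnNge; apply/negP => lQ; case/negP: G3; apply/existsP; exists W.
  by rewrite /D3 Wk eqxx lQ andbT.
have closedM g : g \in E -> #|closed_copies E W G g|%:R <= M.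
  move=> gE; rewrite leNgt; apply/negP => lt; case/negP: G2; apply/existsP; exists (W, g).
  rewrite /B1 negbK in G1; by rewrite /D2 /= Wk eqxx gE G1 lt.
have : (\sum_(g in E) #|closed_copies E W G g| <= s)%N.
  rewrite -(ler_nat R) natr_sum; apply: le_trans closed_le.
  by rewrite mulr_natl -sumr_const; apply: ler_sum.
apply/negP; rewrite -ltnNge.
suff arith (a t c x y z : nat) :
  (a < x -> t <= a + y + c -> x + y + z <= t -> z < c)%N by exact: arith Ql cnt lks.
by clear; lia.
Qed.

End Wins.

(** * Choice of the constants *)

(** Compare with the term of order [B.+1] of the exponential series at [ln k]; the additional power
    of the logarithm absorbs [A] and the factorial. *)
Lemma ln_pow_le (R : realType) (A : R) (B : nat) : exists K : nat, forall k : nat,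
  (K <= k)%N -> 1 <= ln k%:R :> R /\ A * ln k%:R ^+ B <= k%:R.
Proof.
pose T : R := Num.max 1 (A * B.+1`!%:R).
exists (Num.truncn (expR T)).+1 => k Kk.
have Tk : expR T <= k%:R.
  by apply: le_trans (ltW (truncnS_gt _)) _; rewrite ler_nat.
have k0 : 0 < k%:R :> R by apply: lt_le_trans Tk; exact: expR_gt0.
have Tln : T <= ln k%:R by rewrite -ler_expR lnK // posrE.
have [T1 T2] : 1 <= ln k%:R :> R /\ A * B.+1`!%:R <= ln k%:R.
  by split; apply: le_trans Tln; rewrite /T le_max lexx ?orbT.
split=> //; have x0 : 0 <= ln k%:R :> R by lra.
have := expR_ge1Dxn B x0; rewrite lnK ?posrE // => h.
have {h} : ln k%:R ^+ B.+1 / B.+1`!%:R <= k%:R :> R by lra.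
apply: le_trans; rewrite ler_pdivlMr ?ltr0n ?fact_gt0 //.
by rewrite mulrAC exprS ler_wpM2r ?exprn_ge0.
Qed.

Section Constants.
Variables (R : realType) (V : finType) (E : {set {set V}}).
Local Notation v := #|V|.
Local Notation e := #|E|.
Variables (m : R).
Hypothesis E2 : forall x, x \in E -> #|x| = 2%N.
Hypothesis EV : cover E = [set: V].
Hypotheses (e2 : (2 <= e)%N) (v3 : (3 <= v)%N).
Hypothesis mE : m * (v - 2)%:R = (e - 1)%:R.
Hypothesis m1 : 1 <= m.
Hypothesis strictly_balanced : forall J : {set {set V}}, J \subset E -> J != E ->
  (2 <= #|J|)%N -> ((#|J| - 1) * (v - 2) < (e - 1) * (#|cover J| - 2))%N.

(* Variables with defining equations instead of local definitions, so that no
   tactic unfolds them. *)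
Variable C : R.
(** With [q = C * L / k] and [l >= k^2 / 32] this gives [(1 - q) ^+ l <= expR (- (m + 3) * k * L)],
    against at most [expR (m * L * k)] sets [W]. *)
Hypothesis CE : C = 32 * (m + 3).
(** Makes [lam ^- r] equal to [expR (- r)]. *)
Variable lam : R.
Hypothesis lamE : lam = expR 1.
Variable P2 : R.
Hypothesis P2E : P2 = 2 ^+ e.
(** The closed copies will number at most [2 * c * K * k^2]; the next constant [c] makes
    [2 * c * K <= 1 / 16], while [s >= k^2 / 16]. *)
Variable K : R.
Hypothesis KE : K = e%:R * lam * P2 * (1 + e%:R * lam * P2 * 4) * C ^+ (e - 1).
Variable c : R.
Hypothesis cE : c = (32 * (K + 1))^-1.
(** A lower bound, free of [k], for [n.+1 ^ (v - 2) * q ^ (e - 1)]. *)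
Variable eta : R.
Hypothesis etaE : eta = c ^+ (v - 2) * C ^+ (e - 1).
(** Chosen so that [2 * (e * r') + 2 <= K1 * L]. *)
Variable K1 : R.
Hypothesis K1E : K1 = 2 * e%:R * (2 * m + 3) + 2.
Variable Bx : nat.
Hypothesis BxE : Bx = (v * (v - 2))%N.
(** The density hypothesis on proper edge sets will reduce to [Dq * L ^+ Bx.+1 <= k]. *)
Variable Dq : R.
Hypothesis DqE : Dq = K1 ^+ Bx * C / eta ^+ v.
(** Dominates every constant that [k / L] or [k / L ^+ Bx.+1] has to exceed. *)
Variable A : R.
Hypothesis AE : A = C + c^-1 + Dq + 4 * (P2 * e%:R) + 32.

Let C0 : 0 < C. Proof. move: m1; rewrite CE; lra. Qed.
Let lam0 : 0 < lam. Proof. by rewrite lamE expR_gt0. Qed.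
Let lam1 : 1 <= lam. Proof. by rewrite lamE; have := @expR_ge1Dx R 1; lra. Qed.
Let e0R : 1 <= e%:R :> R. Proof. by rewrite ler1n ltnW. Qed.
Let twoe : 1 <= P2. Proof. by rewrite P2E exprn_ege1 // ler1n. Qed.
Let P20 : 0 <= P2. Proof. exact: le_trans twoe. Qed.
Let CK : C ^+ (e - 1) <= K.
Proof.
rewrite KE ler_peMl ?exprn_ge0 ?(ltW C0) //.
have h1 : 1 <= e%:R * lam by rewrite mulr_ege1.
have h2 : 1 <= e%:R * lam * P2 by rewrite mulr_ege1.
rewrite mulr_ege1 // lerDl mulr_ge0 //; exact: le_trans h2.
Qed.
Let K0 : 0 < K. Proof. by apply: lt_le_trans CK; rewrite exprn_gt0. Qed.
Let c0 : 0 < c. Proof. by rewrite cE invr_gt0; move: K0; lra. Qed.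
Let cK : c * (32 * (K + 1)) = 1. Proof. by rewrite cE mulVf // gt_eqF //; move: K0; lra. Qed.
Let c12 : 2 * c <= 1.
Proof. by have := mulr_gt0 c0 K0; move: cK c0; rewrite mulrDr mulrDr; lra. Qed.
Let cK16 : 2 * c * K <= 1 / 16.
Proof. by move: cK c0; rewrite mulrDr mulrDr; lra. Qed.
Let eta0 : 0 < eta. Proof. by rewrite etaE mulr_gt0 ?exprn_gt0. Qed.
Let v2 : (v - 2 = (v - 3).+1)%N. Proof. by rewrite subnSK. Qed.
Let e1 : (e - 1 = (e - 2).+1)%N. Proof. by rewrite subnSK. Qed.
Let eta1 : eta <= 1.
Proof.
have cle : c ^+ (v - 2) <= c.
  by rewrite v2 exprS ler_piMr ?exprn_ile1 ?(ltW c0) //; move: c12 c0; lra.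
have : eta <= c * K.
  by rewrite etaE ler_pM ?exprn_ge0 ?(ltW c0) ?(ltW C0).
by move: cK16; lra.
Qed.
Let K1_ge0 : 0 <= K1.
Proof.
by rewrite K1E addr_ge0 // mulr_ge0 //; [apply: mulr_ge0; rewrite ?ler0n | move: m1; lra].
Qed.
Let D0 : 0 <= Dq.
Proof. by rewrite DqE divr_ge0 ?mulr_ge0 ?exprn_ge0 ?(ltW C0) ?(ltW eta0). Qed.

(** * The estimates for a fixed large [k] *)

Section Fixed.
Variables (k : nat).
Variable L : R.
Hypothesis LE : L = ln k%:R.
Hypothesis L1 : 1 <= L.
Hypothesis large : A * L ^+ Bx.+1 <= k%:R.
Variable q : R.
Hypothesis qE : q = C * L / k%:R.
Variable y : R.
Hypothesis yE : y = (k%:R / L) `^ m.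
Variable n : nat.
Hypothesis nE : n = Num.truncn (c * y).
(** The order of [r] is [k * L], for [lam ^- r] must beat the number of sets [W]; that of [r'] is
    only [L], for [lam ^- r'] must beat the number of pairs. *)
Variable r : nat.
Hypothesis rE : r = (Num.truncn ((m + 2) * k%:R * L)).+1.
Variable r' : nat.
Hypothesis r'E : r' = (Num.truncn ((2 * m + 2) * L)).+1.

Let L0 : 0 < L. Proof. by move: L1; lra. Qed.

Let largeL : A * L <= k%:R.
Proof.
apply: le_trans large; rewrite ler_wpM2l //.
  have : 0 <= c^-1 by rewrite invr_ge0 ltW.
  have : 0 <= P2 * e%:R :> R by rewrite mulr_ge0.
  by move: D0 C0; rewrite AE; lra.
by rewrite exprS ler_peMr ?exprn_ege1 ?(ltW L0).
Qed.

Let sub_A (x : R) : 0 <= x -> x <= A -> x * L <= k%:R.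
Proof. by move=> x0 xA; apply: le_trans largeL; rewrite ler_wpM2r ?(ltW L0). Qed.

Let A_parts : [/\ C <= A, c^-1 <= A, 4 * (P2 * e%:R) <= A & 32 <= A].
Proof.
have h1 : 0 <= c^-1 by rewrite invr_ge0 ltW.
have h2 : 0 <= P2 * e%:R :> R by rewrite mulr_ge0.
by move: D0 C0; rewrite AE; split; lra.
Qed.

Let kR : 32 <= k%:R :> R.
Proof.
case: A_parts => _ _ _ h; have : 32 * L <= k%:R by apply: sub_A.
by move: L1; lra.
Qed.

Let kR0 : 0 < k%:R :> R. Proof. by move: kR; lra. Qed.

Let q0 : 0 < q. Proof. by rewrite qE divr_gt0 ?mulr_gt0. Qed.

Let q1 : q <= 1.
Proof.
rewrite qE ler_pdivrMr // mul1r; case: A_parts => h _ _ _.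
by apply: sub_A; rewrite ?(ltW C0).
Qed.

Let kL1 : c^-1 <= k%:R / L.
Proof.
rewrite ler_pdivlMr //; case: A_parts => _ h _ _.
by apply: sub_A; rewrite ?invr_ge0 ?(ltW c0).
Qed.

Let cinv1 : 1 <= c^-1.
Proof. by rewrite invr_ge1 ?unitfE ?gt_eqF //; move: c12 c0; lra. Qed.

Let kLge1 : 1 <= k%:R / L. Proof. exact: le_trans cinv1 kL1. Qed.

Let cy1 : 1 <= c * y.
Proof.
have : c^-1 <= y by rewrite yE; apply: le_trans kL1 _; apply: le1r_powR.
by rewrite [c * y]mulrC -ler_pdivrMr // div1r.
Qed.

Let y0 : 0 < y. Proof. by rewrite yE powR_gt0 // divr_gt0. Qed.

Let n_lo : c * y <= n.+1%:R. Proof. rewrite nE; exact: ltW (truncnS_gt _). Qed.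

Let n_hi : n.+1%:R <= 2 * c * y.
Proof.
have : n%:R <= c * y by rewrite nE truncn_le; move: cy1; lra.
by rewrite -natr1; move: cy1; lra.
Qed.

Let y_pow : y ^+ (v - 2) = (k%:R / L) ^+ (e - 1).
Proof.
by rewrite -powR_mulrn ?(ltW y0) // yE -powRrM mE powR_mulrn // divr_ge0 // ltW.
Qed.

(** By [mE] the powers of [k / L] cancel: [y] is the scale of [n] at which the expected number of
    copies closing a given pair stays bounded. *)
Let yq : y ^+ (v - 2) * q ^+ (e - 1) = C ^+ (e - 1).
Proof.
rewrite y_pow -exprMn; congr (_ ^+ _); rewrite qE.
by field; rewrite !gt_eqF.
Qed.

Variable Y : R.
Hypothesis YE : Y = n.+1%:R ^+ (v - 2) * q ^+ (e - 1).

Let Y_lo : eta <= Y.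
Proof.
rewrite YE etaE -yq mulrA -exprMn ler_wpM2r ?exprn_ge0 ?(ltW q0) //.
by apply: lerXn2r; rewrite ?nnegrE ?ler0n // mulr_ge0 ?(ltW c0) ?(ltW y0).
Qed.

Let Y_hi : Y <= 2 * c * C ^+ (e - 1).
Proof.
have c2 : 0 <= 2 * c by move: c0; lra.
apply: (@le_trans _ _ ((2 * c) ^+ (v - 2) * C ^+ (e - 1))).
  rewrite YE -yq mulrA -exprMn ler_wpM2r ?exprn_ge0 ?(ltW q0) //.
  by apply: lerXn2r; rewrite ?nnegrE ?ler0n // mulr_ge0 ?(ltW y0).
rewrite ler_wpM2r ?exprn_ge0 ?(ltW C0) //.
by rewrite v2 exprS ler_piMr ?exprn_ile1.
Qed.

Let r_lo : (m + 2) * k%:R * L <= r%:R. Proof. rewrite rE; exact: ltW (truncnS_gt _). Qed.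

Let r_hi : r%:R <= (m + 3) * k%:R * L.
Proof.
have kL : 1 <= k%:R * L by rewrite mulr_ege1 //; move: kR; lra.
have p0 : 0 <= (m + 2) * k%:R * L.
  by rewrite -mulrA mulr_ge0 //; move: m1 kL; lra.
have := truncn_le ((m + 2) * k%:R * L); rewrite p0 => h.
by move: h kL; rewrite rE -natr1 -!mulrA !mulrDl; lra.
Qed.

Let r'_lo : (2 * m + 2) * L <= r'%:R. Proof. rewrite r'E; exact: ltW (truncnS_gt _). Qed.

Let r'_hi : r'%:R <= (2 * m + 3) * L.
Proof.
have p0 : 0 <= (2 * m + 2) * L by rewrite mulr_ge0 ?(ltW L0) //; move: m1; lra.
have := truncn_le ((2 * m + 2) * L); rewrite p0 => h.
by move: h L1; rewrite r'E -natr1 !mulrDl; lra.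
Qed.

Let n_exp : n.+1%:R <= expR (m * L).
Proof.
apply: (le_trans n_hi); apply: (@le_trans _ _ y); first by rewrite ler_piMl ?(ltW y0).
have kE : expR (m * L) = k%:R `^ m by rewrite mulrC expRM LE lnK // posrE.
rewrite kE yE ge0_ler_powR ?nnegrE ?(ltW kR0) ?divr_ge0 ?(ltW kR0) ?(ltW L0) //.
  by move: m1; lra.
by rewrite ler_pdivrMr // ler_peMr // ltW.
Qed.

Let n_expk : (n.+1 ^ k)%:R <= expR (m * L * k%:R).
Proof. by rewrite natrX expRM_natr lerXn2r ?nnegrE ?ler0n ?expR_ge0. Qed.

Let lamV j : lam ^- j = expR (- j%:R).
Proof. by rewrite lamE -expRM_natr mul1r expRN. Qed.

Let kL : k%:R <= k%:R * L. Proof. by rewrite ler_peMr // ltW. Qed.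

Let bad1 : (2 ^ e * e * n.+1 ^ 2)%:R * lam ^- r' <= 1 / 4.
Proof.
rewrite lamV natrM natrX natrM natrX -P2E.
apply: (@le_trans _ _ (P2 * e%:R * expR (m * L) ^+ 2 * expR (- ((2 * m + 2) * L)))).
  rewrite ler_pM ?mulr_ge0 ?exprn_ge0 ?expR_ge0 ?ler0n //.
    rewrite ler_wpM2l ?mulr_ge0 ?exprn_ge0 ?ler0n //.
    by rewrite lerXn2r ?nnegrE ?ler0n ?expR_ge0.
  by rewrite ler_expR lerN2.
rewrite -expRM_natl -mulrA -expRD.
have -> : 2 * (m * L) + - ((2 * m + 2) * L) = - (L * 2%:R) by ring.
rewrite expRN expRM_natr {1}LE lnK ?posrE // ler_pdivrMr ?exprn_gt0 //.
case: A_parts => _ _ h _.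
have : 4 * (P2 * e%:R) * L <= k%:R.
  by apply: sub_A => //; rewrite !mulr_ge0 ?exprn_ge0 ?ler0n.
have : 4 * (P2 * e%:R) <= 4 * (P2 * e%:R) * L.
  by rewrite ler_peMr // !mulr_ge0 ?exprn_ge0 ?ler0n.
have : k%:R <= k%:R ^+ 2 :> R by rewrite expr2 ler_peMr ?(ltW kR0) //; move: kR; lra.
lra.
Qed.

Let bad2 : (n.+1 ^ k * e)%:R * lam ^- r <= 1 / 4.
Proof.
rewrite lamV natrM.
apply: (@le_trans _ _ (expR (m * L * k%:R) * e%:R * expR (- ((m + 2) * k%:R * L)))).
  rewrite ler_pM ?mulr_ge0 ?expR_ge0 ?ler0n //.
    by rewrite ler_wpM2r ?ler0n.
  by rewrite ler_expR lerN2.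
rewrite mulrAC -expRD.
have -> : m * L * k%:R + - ((m + 2) * k%:R * L) = - (2 * (k%:R * L)) by ring.
rewrite mulrC expRN ler_pdivrMr ?expR_gt0 //.
have := expR_ge1Dx (2 * (k%:R * L)); move: kL.
case: A_parts => _ _ h _.
have h1 : 4 * (P2 * e%:R) * L <= k%:R.
  by apply: sub_A => //; rewrite !mulr_ge0 ?exprn_ge0 ?ler0n.
have h2 : 4 * (P2 * e%:R) <= 4 * (P2 * e%:R) * L.
  by rewrite ler_peMr // !mulr_ge0 ?exprn_ge0 ?ler0n.
have h3 : e%:R <= P2 * e%:R :> R by rewrite ler_peMl ?ler0n.
have h4 : 0 < k%:R :> R by [].
lra.
Qed.

Variable l : nat.
Hypothesis lE : l = (k * k %/ 16)%N.
Variable s : nat.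
Hypothesis sE : s = (k * k %/ 8)%N.
Variable d : nat.
Hypothesis dE : d = (k %/ 8)%N.

Let k32 : (32 <= k)%N. Proof. by rewrite -(ler_nat R). Qed.

Let l_lo : k%:R ^+ 2 <= 32 * l%:R :> R.
Proof.
rewrite -natrX -natrM ler_nat -mulnn lE; have := divn_eq (k * k) 16.
have := ltn_pmod (k * k) (isT : 0 < 16)%N.
have : (32 <= k * k)%N by rewrite (leq_trans k32) // leq_pmulr // (leq_trans _ k32).
move: (k * k)%N => kk; move: (kk %/ 16)%N (kk %% 16)%N => a b; clear; lia.
Qed.

Let s_lo : k%:R ^+ 2 <= 16 * s%:R :> R.
Proof.
rewrite -natrX -natrM ler_nat -mulnn sE; have := divn_eq (k * k) 8.
have := ltn_pmod (k * k) (isT : 0 < 8)%N.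
have : (32 <= k * k)%N by rewrite (leq_trans k32) // leq_pmulr // (leq_trans _ k32).
move: (k * k)%N => kk; move: (kk %/ 8)%N (kk %% 8)%N => a b; clear; lia.
Qed.

(** The left side is at most [5 k^2 / 16], which leaves room below [k (k - 1) / 2] for [k >= 32]. *)
Let lks : (l + k * d + s <= 'C(k, 2))%N.
Proof.
have h : (2 * (l + k * d + s) <= k * k.-1)%N.
  have hl : (16 * l <= k * k)%N by rewrite lE mulnC leq_divM.
  have hs : (8 * s <= k * k)%N by rewrite sE mulnC leq_divM.
  have hd : (8 * (k * d) <= k * k)%N by rewrite dE mulnCA leq_mul2l mulnC leq_divM orbT.
  have hk : (k * k.-1 + k = k * k)%N by rewrite -mulnSr prednK // (leq_trans _ k32).
  have h32 : (32 * k <= k * k)%N by rewrite leq_mul2r k32 orbT.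
  move: hl hs hd hk h32; move: (k * d)%N (k * k)%N (k * k.-1)%N l s => a b f g i.
  by clear; lia.
by rewrite bin2 -divn2 leq_divRL // mulnC.
Qed.

Let bad3 : (n.+1 ^ k)%:R * (1 - q) ^+ l <= 1 / 4.
Proof.
have h1q : 0 <= 1 - q by move: q1; lra.
apply: (@le_trans _ _ (expR (m * L * k%:R) * expR (- ((m + 3) * k%:R * L)))).
  rewrite ler_pM ?exprn_ge0 ?ler0n //.
  apply: (@le_trans _ _ (expR (- q) ^+ l)).
    by rewrite lerXn2r ?nnegrE ?expR_ge0 //; have := expR_ge1Dx (- q); lra.
  rewrite -expRM_natr ler_expR mulNr lerN2 qE CE.
  have -> : 32 * (m + 3) * L / k%:R * l%:R = (m + 3) * L / k%:R * (32 * l%:R) by ring.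
  have -> : (m + 3) * k%:R * L = (m + 3) * L / k%:R * k%:R ^+ 2 by field; rewrite gt_eqF.
  rewrite ler_wpM2l // divr_ge0 ?mulr_ge0 ?(ltW L0) ?(ltW kR0) //.
  by move: m1; lra.
rewrite -expRD.
have -> : m * L * k%:R + - ((m + 3) * k%:R * L) = - (3 * (k%:R * L)) by ring.
rewrite expRN -div1r ler_pdivrMr ?expR_gt0 //.
have := expR_ge1Dx (3 * (k%:R * L)); move: kL kR; lra.
Qed.

Let closed_le : e%:R * (lam * closed_bound n.+1 q E lam k r) <= s%:R.
Proof.
have Y0 : 0 <= Y by apply: le_trans Y_lo; rewrite ltW.
have bnd : closed_bound n.+1 q E lam k r <=
    P2 * (1 + e%:R * lam * P2 * 4) * Y * k%:R ^+ 2.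
  rewrite /closed_bound -P2E -!mulrA ler_wpM2l ?exprn_ge0 //.
  have -> : (1 + e%:R * (lam * (P2 * 4))) * (Y * k%:R ^+ 2) =
     k%:R ^+ 2 * Y + e%:R * (lam * (P2 * 4)) * (Y * k%:R ^+ 2).
    by move: (e%:R) (k%:R) => a1 a2; ring.
  rewrite YE mulrA; apply: lerD => //.
  have -> : (e * r)%:R * (lam * (P2 * (4 * (n.+1%:R ^+ (v - 2) * q ^+ (e - 2)))))
      = e%:R * (lam * (P2 * 4)) * (n.+1%:R ^+ (v - 2) * q ^+ (e - 2) * r%:R).
    by rewrite natrM; move: (_ ^+ (v - 2)) (_ ^+ (e - 2)) (e%:R) (r%:R) => a1 a2 a3 a4; ring.
  rewrite ler_wpM2l ?mulr_ge0 ?exprn_ge0 ?(ltW lam0) ?ler0n //.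
  rewrite e1 exprSr mulrA -[leRHS]mulrA ler_wpM2l ?mulr_ge0 ?exprn_ge0 ?ler0n ?(ltW q0) //.
  (* Here [r <= C * k * L = q * k^2], so the second term of [closed_bound] has the order of the
     first. *)
  apply: (le_trans r_hi); rewrite qE.
  have -> : C * L / k%:R * k%:R ^+ 2 = C * k%:R * L by field; rewrite gt_eqF.
  by rewrite -!mulrA ler_wpM2r ?mulr_ge0 ?(ltW L0) ?(ltW kR0) // CE; move: m1; lra.
apply: (@le_trans _ _ (e%:R * (lam * (P2 * (1 + e%:R * lam * P2 * 4) *
   (2 * c * C ^+ (e - 1)) * k%:R ^+ 2)))).
  rewrite ler_wpM2l ?ler0n // ler_wpM2l ?(ltW lam0) //.
  apply: (le_trans bnd); rewrite ler_wpM2r ?exprn_ge0 ?(ltW kR0) //.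
  rewrite ler_wpM2l // mulr_ge0 ?exprn_ge0 // addr_ge0 //.
  by rewrite !mulr_ge0 ?exprn_ge0 ?(ltW lam0) ?ler0n.
have -> : e%:R * (lam * (P2 * (1 + e%:R * lam * P2 * 4) *
   (2 * c * C ^+ (e - 1)) * k%:R ^+ 2)) = 2 * c * K * k%:R ^+ 2.
  by rewrite KE; move: (C ^+ _) (e%:R) (k%:R) => a1 a2 a3; ring.
have : 2 * c * K * k%:R ^+ 2 <= 1 / 16 * k%:R ^+ 2.
  by rewrite ler_wpM2r ?exprn_ge0 ?(ltW kR0).
by move: s_lo; lra.
Qed.

(** Raise to the power [v - 2]. For the right side [X], one has [X ^+ (v - 2) * q ^+ delta = Y ^+
    (#|cover J| - 2)], and strict balance gives [delta >= 1]. So [X ^+ (v - 2)] is at least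
    [eta ^+ v / q], of order [k / L], while the left side is a power of [L]. *)
Let balanced (J : {set {set V}}) : J \subset E -> J != E -> (2 <= #|J|)%N ->
  (2 * (e * r') + 2)%:R ^+ v <= n.+1%:R ^+ (#|cover J| - 2) * q ^+ (#|J| - 1) :> R.
Proof.
move=> JE JnE J2.
have lt := strictly_balanced JE JnE J2.
have n1R : 0 < n.+1%:R :> R by rewrite ltr0n.
set X := n.+1%:R ^+ _ * q ^+ _.
have X0 : 0 < X by rewrite mulr_gt0 ?exprn_gt0.
rewrite -(@ler_pXn2r _ (v - 2)) ?nnegrE ?exprn_ge0 ?ler0n ?(ltW X0) //; last by rewrite v2.
rewrite -exprM -BxE.
pose delta := ((e - 1) * (#|cover J| - 2) - (#|J| - 1) * (v - 2))%N.
have delta1 : (delta = delta.-1.+1)%N by rewrite prednK // subn_gt0.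
have XY : X ^+ (v - 2) * q ^+ delta = Y ^+ (#|cover J| - 2).
  rewrite /X YE !exprMn -!exprM -mulrA -exprD [in LHS]mulnC.
  by congr (_ * _ ^+ _); rewrite /delta subnKC // ltnW.
have Xq : eta ^+ v <= X ^+ (v - 2) * q.
  apply: (@le_trans _ _ (X ^+ (v - 2) * q ^+ delta)); last first.
    rewrite ler_wpM2l ?exprn_ge0 ?(ltW X0) // delta1 exprS ler_piMr ?(ltW q0) //.
    by rewrite exprn_ile1 ?(ltW q0).
  rewrite XY; apply: (@le_trans _ _ (eta ^+ (#|cover J| - 2))).
    rewrite ler_wiXn2l ?(ltW eta0) //.
    by rewrite leq_subLR (leq_trans (max_card _)) // leq_addl.
  by rewrite lerXn2r ?nnegrE ?(ltW eta0) // (le_trans _ Y_lo) // ltW.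
have U : (2 * (e * r') + 2)%:R <= K1 * L.
  rewrite natrD !natrM K1E.
  have : e%:R * r'%:R <= e%:R * ((2 * m + 3) * L) by rewrite ler_wpM2l ?ler0n.
  have -> : (2 * e%:R * (2 * m + 3) + 2) * L = 2 * (e%:R * ((2 * m + 3) * L)) + 2 * L.
    by move: (e%:R) => a1; ring.
  by move=> h; rewrite lerD ?ler_wpM2l // ler_peMr.
apply: (@le_trans _ _ ((K1 * L) ^+ Bx)).
  by rewrite lerXn2r ?nnegrE ?ler0n // mulr_ge0 ?(ltW L0).
apply: (@le_trans _ _ (eta ^+ v / q)); last by rewrite ler_pdivrMr.
rewrite ler_pdivlMr // qE exprMn.
have -> : K1 ^+ Bx * L ^+ Bx * (C * L / k%:R) = K1 ^+ Bx * C * L ^+ Bx.+1 / k%:R.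
  by rewrite exprSr; ring.
rewrite ler_pdivrMr // [leRHS]mulrC -ler_pdivrMr ?exprn_gt0 // mulrAC -DqE.
apply: le_trans large; rewrite ler_wpM2r ?exprn_ge0 ?(ltW L0) // AE.
have h1 : 0 <= C + c^-1 by rewrite addr_ge0 ?invr_ge0 ?(ltW c0) ?(ltW C0).
have h2 : 0 <= 4 * (P2 * e%:R) + 32 by rewrite addr_ge0 ?mulr_ge0 ?ler0n.
by rewrite -[_ + Dq + _ + _]addrA [_ + Dq]addrC -addrA lerDl addr_ge0.
Qed.

Lemma painter_survives b N : legal b -> N%:R <= c / 32 * (k%:R * y) ->
  exists p, ~ red_copy E (play b p N) /\ ~ has_copy (complete k) (colored (play b p N) blue).
Proof.
move=> lb Nle.
have d0 : (0 < d)%N by rewrite dE divn_gt0 // (leq_trans _ k32).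
have dk : (d < k)%N by rewrite dE ltn_Pdiv // (leq_trans _ k32).
apply: (@painter_wins R V E k d n r r' l s q lam) => //.
(* This 16 and the 2 in the bound on [2 * N] make up the 32 of the statement. *)
have kd : k%:R <= 16 * d%:R :> R.
  rewrite -natrM ler_nat dE; have := divn_eq k 8; have := ltn_pmod k (isT : 0 < 8)%N.
  by move: k32; move: (k %/ 8)%N (k %% 8)%N => a f; clear; lia.
rewrite -(ler_nat R) !natrM.
apply: (@le_trans _ _ (2 * (c / 32 * (k%:R * y)))); first by rewrite ler_wpM2l.
have -> : 2 * (c / 32 * (k%:R * y)) = (k%:R / 16) * (c * y) by field.
have kd' : k%:R / 16 <= d%:R :> R by rewrite ler_pdivrMr // mulrC.
by rewrite (ler_pM _ _ kd' n_lo) ?mulr_ge0 ?(ltW c0) ?(ltW y0) ?invr_ge0.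
Qed.

End Fixed.

Lemma painter_survives_eventually : exists2 kap : R, 0 < kap & exists K0 : nat,
  forall k N b, (K0 <= k)%N -> legal b ->
    N%:R <= kap * (k%:R * (k%:R / ln k%:R) `^ m) ->
  exists p, ~ red_copy E (play b p N) /\ ~ has_copy (complete k) (colored (play b p N) blue).
Proof.
exists (c / 32); first by rewrite divr_gt0.
have [K0' hK] := ln_pow_le A Bx.+1.
by exists K0' => k N b /hK[L1 large] lb Nle;
  apply: (painter_survives erefl L1 large erefl erefl erefl erefl erefl erefl erefl erefl erefl lb Nle).
Qed.

End Constants.

(** * Strictly balanced subgraphs *)

Lemma lt_online_ramsey (H : sgraph) (k T : nat) :
  (forall N, (N <= T)%N -> ~ builder_forces H k N) -> (T < online_ramsey H k)%N.
Proof.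
move=> hT; rewrite /online_ramsey; case: ex_minnP => N /asboolP fN _.
by rewrite ltnNge; apply/negP => /hT.
Qed.

Lemma mem_edges (H : sgraph) (x y : H) : ([set x; y] \in edges H) = adj x y.
Proof.
apply/imsetP/idP => [[[a c] /= aac e]|xy]; last by exists (x, y).
rewrite inE /= in aac.
have /set2P[xa|xc] : x \in [set a; c] by rewrite -e set21.
  have /set2P[ya|-> //] : y \in [set a; c] by rewrite -e set22.
    have /set2P[cx|cy] : c \in [set x; y] by rewrite e set22.
      by move: aac; rewrite cx xa adj_irr.
    by move: aac; rewrite cy ya adj_irr.
  by rewrite xa.
have /set2P[->|yc] : y \in [set a; c] by rewrite -e set22.
  by rewrite xc adj_sym.
have /set2P[ax|ay] : a \in [set x; y] by rewrite e set21.
  by move: aac; rewrite ax xc adj_irr.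
by move: aac; rewrite ay yc adj_irr.
Qed.

Lemma card_edge (H : sgraph) (x : {set H}) : x \in edges H -> #|x| = 2%N.
Proof.
case/imsetP => -[a c]; rewrite inE /= => ac ->; rewrite cards2.
by case: eqVneq ac => // ->; rewrite adj_irr.
Qed.

(** Against the answer blue at every turn no copy of [H] arises, so Builder has to complete a
    clique; summing degrees over it gives the bound. *)
Lemma forces_all_pairs (H : sgraph) (k N : nat) : (1 <= #|edges H|)%N ->
  builder_forces H k N -> (k * k.-1 <= 2 * N)%N.
Proof.
case/card_gt0P => x xH [b [lb /(_ (fun _ _ => blue))]].
set h := play _ _ _ => -[[f [_ fH]]|[f [finj fb]]].
  case/imsetP: xH => -[a c]; rewrite inE /= => /fH ac _.
  have nored M u v : ~ colored (play b (fun _ _ => blue) M) red u v.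
    by elim: M => //= M IHM /colored_cons[|[]].
  by case: (nored _ _ _ ac).
have -> : N = size h by rewrite size_play.
apply: leq_trans (@sum_deg h [seq f i | i <- enum 'I_k] _); last first.
  by rewrite map_inj_uniq ?enum_uniq.
rewrite big_map big_enum /= -{1}(card_ord k) -sum_nat_const; apply: leq_sum => i _.
have -> : k.-1 = size [seq f j | j <- enum [set~ i]].
  by rewrite size_map -cardE cardsC1 card_ord.
apply: deg_ge; first by rewrite map_inj_uniq ?enum_uniq.
move=> y /mapP[j]; rewrite mem_enum !inE => ij ->; exists blue.
by apply: fb; rewrite /= eq_sym.
Qed.

Section M2.
Variables (R : realType) (H : sgraph).

Lemma le_m2 (F : {set H} * {set {set H}}) : is_subgraph F -> m2_term R F <= m2 R H.
Proof. by move=> sF; rewrite /m2; apply: le_bigmax_cond. Qed.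

(** A positive maximum is not the default value 0, so it is one of the terms. *)
Lemma m2_attained : 0 < m2 R H ->
  exists2 F : {set H} * {set {set H}}, is_subgraph F & m2_term R F = m2 R H.
Proof.
move=> m0; apply: contrapT => nex.
suff : m2 R H < m2 R H by rewrite ltxx.
rewrite {1}/m2; apply/bigmax_ltP; split=> // F sF.
rewrite lt_neqAle le_m2 // andbT; apply/eqP => e; apply: nex.
by exists F.
Qed.

Let term (J : {set {set H}}) : R := m2_term R (cover J, J).

Lemma subgraph_cover (J : {set {set H}}) : J \subset edges H -> is_subgraph (cover J, J).
Proof.
move=> JH; rewrite /is_subgraph JH /=; apply/forall_inP => x xJ.
by apply: bigcup_sup.
Qed.

Lemma m2_term_cover (J : {set {set H}}) : J \subset edges H -> (2 <= #|J|)%N ->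
  (2 < #|cover J|)%N /\ term J = (#|J| - 1)%:R / (#|cover J| - 2)%:R.
Proof.
move=> JH J2.
have c3 : (2 < #|cover J|)%N by apply: cover2_gt2 J2 => x /(subsetP JH)/card_edge.
split=> //; rewrite /term /m2_term /= c3 (gtn_eqF c3) /= addr0.
by rewrite !natrB // ltnW.
Qed.

(** Among the edge sets whose term equals [m2], take one with fewest edges; every smaller edge set
    then has a strictly smaller term. *)
Lemma m2_extremal : 1 < m2 R H -> exists E : {set {set H}},
  [/\ E \subset edges H, (2 <= #|E|)%N, (3 <= #|cover E|)%N,
      m2 R H * (#|cover E| - 2)%:R = (#|E| - 1)%:R &
      forall J : {set {set H}}, J \subset E -> J != E -> (2 <= #|J|)%N ->
        ((#|J| - 1) * (#|cover E| - 2) < (#|E| - 1) * (#|cover J| - 2))%N].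
Proof.
move=> m1.
have tle (J : {set {set H}}) : J \subset edges H -> term J <= m2 R H.
  by move=> JH; apply: le_m2; apply: subgraph_cover.
have [F sF tF] : exists2 F : {set H} * {set {set H}}, is_subgraph F & m2_term R F = m2 R H.
  by apply: m2_attained; apply: lt_trans m1.
pose P (J : {set {set H}}) := (J \subset edges H) && (term J == m2 R H).
(* With at most one edge the term is at most 1/2, hence below [m2]. *)
have gt1 J : P J -> (2 <= #|J|)%N.
  case/andP => JH /eqP tJ; rewrite ltnNge; apply/negP => J1.
  suff : term J <= 1 by rewrite tJ leNgt m1.
  have J1R : #|J|%:R <= 1 :> R by rewrite lern1.
  rewrite /term /m2_term /=; case: ltnP => c3.
    rewrite (gtn_eqF c3) /= addr0; apply: (@le_trans _ _ 0) => //.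
    by rewrite mulr_le0_ge0 ?subr_le0 // invr_ge0 subr_ge0 ler_nat ltnW.
  by rewrite add0r; case: ifP => // _; lra.
(* Dropping the isolated vertices of [F] can only shrink the denominator. *)
have PF : P F.2.
  case/andP: (sF) => FH /forall_inP Fsub; rewrite /P FH eq_le tle //= -tF.
  have F3 : (2 < #|F.1|)%N.
    rewrite ltnNge; apply/negP => F3; move: m1; rewrite -tF /m2_term.
    by rewrite ltnNge F3 /= add0r; case: ifP => _; lra.
  have tFE : m2_term R F = (#|F.2|%:R - 1) / (#|F.1|%:R - 2).
    by rewrite /m2_term F3 (gtn_eqF F3) /= addr0.
  have d0 : 0 < #|F.1|%:R - 2 :> R by rewrite subr_gt0 ltr_nat.
  have F2 : (2 <= #|F.2|)%N.
    move: m1; rewrite -tF tFE ltr_pdivlMr // mul1r => lt.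
    by rewrite -(ltr_nat R); move: d0 lt; lra.
  have [c3 ->] := m2_term_cover FH F2.
  rewrite tFE !natrB ?(ltnW c3) ?(ltnW F2) // ler_wpM2l //.
    by rewrite subr_ge0 ler1n ltnW.
  rewrite lef_pV2 ?posrE // ?subr_gt0 ?ltr_nat // lerD2r ler_nat.
  apply: subset_leq_card; apply/subsetP => z /bigcupP[x xF zx].
  exact: subsetP (Fsub x xF) z zx.
pose E := [arg min_(J < F.2 | P J) #|J|].
have [PE Emin] : P E /\ forall J, P J -> (#|E| <= #|J|)%N.
  by rewrite /E; case: arg_minnP.
have E2 := gt1 E PE; case/andP: (PE) => EH /eqP tE.
have [c3 tE'] := m2_term_cover EH E2.
have cE0 : 0 < (#|cover E| - 2)%:R :> R by rewrite ltr0n subn_gt0.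
exists E; split=> //; first by rewrite -tE tE' divfK // gt_eqF.
move=> J JE JnE J2.
have JH := subset_trans JE EH.
have [cJ3 tJ'] := m2_term_cover JH J2.
have cJ0 : 0 < (#|cover J| - 2)%:R :> R by rewrite ltr0n subn_gt0.
have lt : term J < term E.
  rewrite tE lt_neqAle tle // andbT; apply/negP => tJ.
  have := Emin J; rewrite /P JH tJ => /(_ isT); apply/negP; rewrite -ltnNge.
  by apply: proper_card; rewrite properEneq JnE.
by move: lt; rewrite tJ' tE' ltr_pdivrMr // mulrAC ltr_pdivlMr // -!natrM ltr_nat.
Qed.

End M2.

(** * The extremal edge set on its own vertex type *)

Section Support.
Variables (H : sgraph) (E : {set {set H}}).
Hypothesis EH : E \subset edges H.

(** Only the covered vertices are kept, so that the edges cover the whole type, as the painter's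
    analysis requires. *)
Definition support : finType := {x : H | x \in cover E}.
Definition to_support (x : {set H}) : {set support} := [set z | val z \in x].
Definition support_edges : {set {set support}} := [set to_support x | x in E].

Lemma to_supportK (x : {set H}) : x \in E -> [set val z | z in to_support x] = x.
Proof.
move=> xE; apply/setP => t; apply/imsetP/idP => [[z]|tx]; first by rewrite inE => zx ->.
have tE : t \in cover E by apply/bigcupP; exists x.
by exists (Sub t tE : support); rewrite ?inE SubK.
Qed.

Let up (y : {set support}) : {set H} := [set val z | z in y].

Let up_inj : injective up. Proof. exact/imset_inj/val_inj. Qed.

Let up_edge (y : {set support}) : y \in support_edges -> up y \in E.
Proof. by case/imsetP => x xE ->; rewrite /up to_supportK. Qed.

Lemma card_support : #|support| = #|cover E|.
Proof. by rewrite card_sig; apply: eq_card => x; rewrite inE. Qed.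

Lemma card_support_edges : #|support_edges| = #|E|.
Proof.
rewrite /support_edges card_in_imset // => x y xE yE e.
by rewrite -(to_supportK xE) -(to_supportK yE) e.
Qed.

Lemma card_support_edge (y : {set support}) : y \in support_edges -> #|y| = 2%N.
Proof.
move=> yE; rewrite -(card_imset (mem y) val_inj).
exact/card_edge/(subsetP EH)/up_edge.
Qed.

Lemma cover_support_edges : cover support_edges = [set: support].
Proof.
apply/setP => z; rewrite inE; have /bigcupP[x xE zx] := valP z.
by apply/bigcupP; exists (to_support x); [exact: imset_f | rewrite inE].
Qed.

(** [up] and [val] are injective, so sizes of edge sets and of covers are unchanged. *)
Lemma support_balanced (a c : nat) :
  (forall J : {set {set H}}, J \subset E -> J != E -> (2 <= #|J|)%N ->
    (#|J| - 1) * a < c * (#|cover J| - 2))%N ->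
  forall J : {set {set support}}, J \subset support_edges -> J != support_edges ->
    (2 <= #|J|)%N -> ((#|J| - 1) * a < c * (#|cover J| - 2))%N.
Proof.
move=> bal J JE JnE J2.
have cJ : #|up @: J| = #|J| by rewrite card_imset.
have cov : cover (up @: J) = [set val z | z in cover J].
  apply/setP => t; apply/bigcupP/imsetP.
    case=> _ /imsetP[y yJ ->] /imsetP[z zy ->]; exists z => //.
    by apply/bigcupP; exists y.
  case=> z /bigcupP[y yJ zy] ->; exists (up y); apply: imset_f => //.
have := bal (up @: J); rewrite cJ cov (card_imset _ val_inj); apply=> //.
  by apply/subsetP => _ /imsetP[y /(subsetP JE)/up_edge yE ->].
apply: contraNneq JnE => e; rewrite eqEcard JE card_support_edges -e cJ.
exact: leqnn.
Qed.

Lemma copy_support h : has_copy H (colored h red) -> red_copy support_edges h.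
Proof.
case=> f [finj fH]; exists (fun z => f (val z)); split=> [z t /finj/val_inj //|z t ztE].
apply: fH; rewrite -mem_edges; apply: (subsetP EH).
by rewrite -[X in X \in E](_ : up [set z; t] = _) ?up_edge // /up imsetU1 imset_set1.
Qed.

End Support.

(** * The lower bound for all large [k] *)

Lemma online_ramsey_eventually (R : realType) (H : sgraph) : (1 <= #|edges H|)%N ->
  exists2 kap : R, 0 < kap & exists K : nat, forall k : nat, (K <= k)%N ->
    kap * (k%:R * (k%:R / ln k%:R) `^ m2 R H) <= (online_ramsey H k)%:R.
Proof.
move=> eH; have [m1|m1] := leP (m2 R H) 1.
  exists (1 / 4); first by lra.
  have [K hK] := @ln_pow_le R 2 1.
  exists K => k /hK[L1 large].
  have k2 : 2 <= k%:R :> R by move: large; rewrite expr1; lra.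
  have kL : 1 <= k%:R / ln k%:R :> R by rewrite ler_pdivlMr; move: large; rewrite ?expr1; lra.
  have pw : (k%:R / ln k%:R) `^ m2 R H <= k%:R.
    apply: (le_trans (ler1_powR kL m1)).
    by rewrite ler_pdivrMr ?ler_peMr //; lra.
  have forced : (k * k.-1 <= 2 * online_ramsey H k)%N.
    apply: (forces_all_pairs eH); rewrite /online_ramsey.
    by case: ex_minnP => N /asboolP.
  have {forced} : k%:R * (k%:R - 1) <= 2 * (online_ramsey H k)%:R :> R.
    have k0 : (0 < k)%N by rewrite -(ltr_nat R) (lt_le_trans _ k2).
    rewrite -(ler_nat R) !natrM in forced; apply: le_trans forced.
    by rewrite -subn1 natrB.
  have : k%:R * (k%:R / ln k%:R) `^ m2 R H <= k%:R * k%:R by rewrite ler_wpM2l.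
  have : k%:R * 2 <= k%:R * k%:R :> R by rewrite ler_wpM2l.
  by rewrite mulrBr mulr1; lra.
have [E [EH e2 c3 mE bal]] := m2_extremal m1.
have e2' : (2 <= #|support_edges E|)%N by rewrite card_support_edges.
have v3 : (3 <= #|support E|)%N by rewrite card_support.
have mE' : m2 R H * (#|support E| - 2)%:R = (#|support_edges E| - 1)%:R.
  by rewrite card_support card_support_edges.
have bal' : forall J : {set {set support E}}, J \subset support_edges E -> J != support_edges E ->
    (2 <= #|J|)%N ->
    ((#|J| - 1) * (#|support E| - 2) < (#|support_edges E| - 1) * (#|cover J| - 2))%N.
  by rewrite card_support card_support_edges; apply: support_balanced.
have [kap kap0 [K hK]] := painter_survives_eventually (@card_support_edge H E EH)
  (cover_support_edges E) e2' v3 mE' (ltW m1) bal'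
  erefl erefl erefl erefl erefl erefl erefl erefl erefl erefl.
exists kap => //; exists K => k Kk.
(* Builder cannot win within any [N <= T] turns, so the online Ramsey number is at least [T.+1],
   which exceeds [X]. *)
set X := kap * _; pose T := Num.truncn X.
have X0 : 0 <= X by rewrite mulr_ge0 ?(ltW kap0) // mulr_ge0 // powR_ge0.
apply: (le_trans (ltW (truncnS_gt X))); rewrite ler_nat.
apply: lt_online_ramsey => N NT [b [lb forced]].
have NX : N%:R <= X.
  by apply: (@le_trans _ _ (Num.truncn X)%:R); rewrite ?ler_nat // truncn_le.
have [p [nred nblue]] := hK k N b Kk lb NX.
by case: (forced p) => [/(copy_support EH)|].
Qed.

(* Translation into asymptotic notation *)
From mathcomp Require Import classical_sets topology normedtype landau.
Import numFieldNormedType.Exports.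
Local Open Scope classical_set_scope.

Theorem theorem3 (R : realType) (H : sgraph) (eH : (1 <= #|edges H|)%N) :
  (fun k : nat => (online_ramsey H k)%:R : R^o)
    \is 'Omega_\oo (fun k : nat => k%:R * (k%:R / ln k%:R) `^ m2 R H : R^o).
Proof.
have [kap kap0 [K hK]] := @online_ramsey_eventually R H eH.
(* The notation asks for a positive constant and an eventual bound between norms; both functions are
   nonnegative. *)
rewrite qualifE /=; apply/asboolP; exists kap => //.
exists K => // k /= Kk.
rewrite !ger0_norm ?ler0n ?hK // mulr_ge0 ?ler0n ?powR_ge0 //.
Qed.
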